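(* Let $C_n$ be the cyclic quiver with $n+1$ vertices and all arrows in one direction, and let $w=(N_1,\dots,N_r)$ be a sequence of semisimple (nilpotent) representations of $C_n$. Then $$u_w:=u_{[N_1]}\diamond u_{[N_2]}\diamond\dots\diamond u_{[N_r]}=\sum_{[M]\in[\mathcal{A}_w]}u_{[M]}\in\mathcal{H}_0(C_n).$$
   Context: All representations are finite dimensional and nilpotent. Let $S_0,\dots,S_n$ be the simples at the vertices and $S_i[l]$ the unique indecomposable of length $l$ with socle $S_i$. Over every field, isomorphism classes are in bijection with the set $\Pi$ of tuples $\pi=(\pi^{(0)},\dots,\pi^{(n)})$ of partitions, $\pi$ corresponding to $\bigoplus_i\bigoplus_kS_i[\pi^{(i)}_k]$. For representations over a finite field, $F^X_{MN}=\#\{U\le X:U\cong N,\ X/U\cong M\}$; there are Hall polynomials $f^\gamma_{\alpha\beta}\in\mathbb{Q}[q]$, $\alpha,\beta,\gamma\in\Pi$, with $F^X_{MN}=f^\gamma_{\alpha\beta}(|K|)$ for every finite field $K$ and $M,N,X$ of classes $\alpha,\beta,\gamma$ over $K$. $\mathcal{H}_0(C_n)$ is the $\mathbb{Q}$-algebra with basis $u_\pi$, $\pi\in\Pi$ (also written $u_{[M]}$ for $M$ of class $\pi$), and product $u_\alpha\diamond u_\beta=\sum_\gamma f^\gamma_{\alpha\beta}(0)u_\gamma$. $\mathcal{A}_w$ is the set of representations $M$ having a filtration of type $w$, i.e. a chain $M=M_0\supset M_1\supset\dots\supset M_r=0$ of subrepresentations with $M_{i-1}/M_i\cong N_i$ for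 $1\le i\le r$; $[\mathcal{A}_w]$ is the set of their isomorphism classes, regarded as a subset of $\Pi$ (this subset does not depend on the field). *)

(* Defs.v *)
From HB Require Import structures.
From mathcomp Require Import all_boot all_order all_algebra.
From mathcomp Require Import finmap.
From mathcomp Require Import boolp classical_sets functions cardinality fsbigop.
From mathcomp Require Import monalg.

Set Implicit Arguments.
Unset Strict Implicit.
Unset Printing Implicit Defensive.

Import GRing.Theory.

Local Open Scope classical_set_scope.
Local Open Scope ring_scope.

Lemma linfun_fun_linear (K : fieldType) (V W : vectType K) (F0 : V -> W) :
  linear F0 -> linfun F0 =1 F0.
Proof.
move=> linF x.
pose m := GRing.isLinear.Build _ _ _ _ F0 linF.
pose F : {linear V -> W} := HB.pack F0 m.
exact: (lfunE F).
Qed.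

(* The vertices of C_n are 'I_n.+1, with one arrow v -> ordS v out of each
   vertex v, where ordS is the cyclic successor. *)
Record rep (K : fieldType) (n : nat) := Rep {
  space :> 'I_n.+1 -> vectType K;
  arrow : forall v, 'Hom(space v, space (ordS v))
}.

Section Representations.
Context {K : fieldType} {n : nat}.
Implicit Types (M N X : rep K n) (v i : 'I_n.+1).

(* The action of the path of length k starting at v. *)
Fixpoint iter_arrow M v k : 'Hom(M v, M (iter k (@ordS n.+1) v)) :=
  if k is k'.+1 then (arrow M (iter k' (@ordS n.+1) v) \o iter_arrow M v k')%VF
  else \1%VF.

Definition nilpotent_rep M := exists k, forall v, iter_arrow M v k = 0.

Definition isomorphic M N :=
  exists g : forall v, 'Hom(M v, N v),
    (forall v, bijective (g v)) /\
    (forall v, g (ordS v) \o arrow M v = arrow N v \o g v)%VF.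

Definition zero_rep : rep K n := @Rep K n (fun=> 'rV[K]_0) (fun=> 0).

Definition dsum M N : rep K n :=
  @Rep K n (fun v => (M v * N v)%type)
    (fun v => linfun (fun x : M v * N v => (arrow M v x.1, arrow N v x.2))).

Fixpoint bigdsum (m : nat) : ('I_m -> rep K n) -> rep K n :=
  if m is m'.+1
  then fun F => dsum (F ord0) (bigdsum (fun j : 'I_m' => F (lift ord0 j)))
  else fun=> zero_rep.

Definition subspaces M := forall v, {vspace M v}.

Definition is_subrep M (U : subspaces M) :=
  forall v, (arrow M v @: U v <= U (ordS v))%VS.

(* vsproj (U v) is the identity on U v, so for a subrepresentation U the arrows
   are the restrictions of those of M; subrep and quot are only meaningful when
   is_subrep U holds. *)
Definition subrep M (U : subspaces M) : rep K n :=
  @Rep K n (fun v => subvs_of (U v))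
    (fun v => linfun (fun x : subvs_of (U v) =>
       vsproj (U (ordS v)) (arrow M v (vsval x)))).

(* M / U, carried by the complements (U v)^C: M v -> (M / U) v is the
   projection onto (U v)^C along U v. *)
Definition quot_proj M (U : subspaces M) v (x : M v) : subvs_of (U v)^C%VS :=
  vsproj (U v)^C%VS (daddv_pi (U v)^C%VS (U v) x).

Definition quot M (U : subspaces M) : rep K n :=
  @Rep K n (fun v => subvs_of (U v)^C%VS)
    (fun v => linfun (fun x : subvs_of (U v)^C%VS =>
       quot_proj U (arrow M v (vsval x)))).

(* For U contained in W, the subspaces U seen inside of subrep W. *)
Definition sub_in M (W U : subspaces M) : subspaces (subrep W) :=
  fun v => (linfun (vsval : subvs_of (W v) -> M v) @^-1: U v)%VS.

Definition simple_rep M :=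
  (exists v, fullv != 0%VS :> {vspace M v}) /\
  forall U : subspaces M, is_subrep U ->
    (forall v, U v = 0%VS) \/ (forall v, U v = fullv).

Definition semisimple_rep M :=
  exists m (F : 'I_m -> rep K n),
    (forall j, simple_rep (F j)) /\ isomorphic M (bigdsum F).

(* Basis elements of the uniserial representation S_i[l] that live at v.
   S_i[l] has a basis e_0, ..., e_(l-1), where e_j lives at the vertex from
   which i is reached by following j arrows, and the arrows send e_0 to 0 and
   e_(j+1) to e_j; its socle is spanned by e_0. *)
Definition uniserial_basis i (l : nat) v :=
  {j : 'I_l | iter j (@ordS n.+1) v == i}.

Definition uniserial i (l : nat) : rep K n :=
  @Rep K n (fun v => {ffun uniserial_basis i l v -> K^o})
    (fun v => linfun (fun x : {ffun uniserial_basis i l v -> K^o} =>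
       [ffun j : uniserial_basis i l (ordS v) =>
          \sum_(k : uniserial_basis i l v | val (val k) == (val (val j)).+1)
            x k])).

(* The inclusions of the chain need not be strict, as the w_j may be zero. *)
Definition has_filtration (r : nat) (w : 'I_r -> rep K n) M :=
  exists c : nat -> subspaces M,
  [/\ forall v, c 0%N v = fullv,
      forall v, c r v = 0%VS,
      forall j, (j <= r)%N -> is_subrep (c j),
      forall j v, (j < r)%N -> (c j.+1 v <= c j v)%VS
    & forall j : 'I_r, isomorphic (quot (sub_in (c j) (c j.+1))) (w j)].

End Representations.

Arguments uniserial K {n} i l.

Section RepresentationTheory.
Context {K : fieldType} {n : nat}.
Implicit Types (M N X : rep K n) (v i : 'I_n.+1).

Lemma quot_proj_linear M (U : subspaces M) v : linear (@quot_proj K n M U v).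
Proof. by move=> a x y; rewrite /quot_proj !linearP. Qed.

Lemma quot_projB M (U : subspaces M) v (x y : M v) :
  quot_proj U (x - y) = quot_proj U x - quot_proj U y.
Proof. by rewrite /quot_proj !linearB. Qed.

Lemma quot_proj_eq0 M (U : subspaces M) v (x : M v) :
  (quot_proj U x == 0) = (x \in U v).
Proof.
rewrite /quot_proj -(inj_eq (@subvs_inj _ _ _)) vsprojK ?memv_pi // linear0.
have dUC : (U v :&: (U v)^C = 0)%VS by rewrite capv_compl.
have dUC' : ((U v)^C :&: U v = 0)%VS by rewrite capvC.
have := daddv_pi_add (w := x) dUC; rewrite addv_complf memvf => /(_ isT) xE.
apply/eqP/idP => [p0|/(daddv_pi_id dUC) px].
  by rewrite -xE p0 addr0 memv_pi.
by apply: (addrI (daddv_pi (U v) (U v)^C x)); rewrite xE addr0 px.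
Qed.

Lemma quot_proj_surj M (U : subspaces M) v (y : quot U v) :
  quot_proj U (vsval y) = y.
Proof.
rewrite /quot_proj daddv_pi_id ?vsvalK ?subvsP // capvC capv_compl //.
Qed.

Lemma quot_proj_arrow M (U : subspaces M) v (x : M v) : is_subrep U ->
  quot_proj U (arrow M v x) = arrow (quot U) v (quot_proj U x).
Proof.
move=> sU.
have linF : linear (fun y : subvs_of (U v)^C%VS => quot_proj U (arrow M v (vsval y))).
  by move=> a y z; rewrite !linearP quot_proj_linear.
rewrite /= linfun_fun_linear //.
apply/eqP; rewrite -subr_eq0 -quot_projB -linearB quot_proj_eq0.
apply: (subvP (sU v)); apply: memv_img.
by rewrite -quot_proj_eq0 quot_projB (quot_proj_surj (U := U)) subrr.
Qed.

Lemma uniserial_arrowE i l v (x : uniserial K i l v) (j : uniserial_basis i l (ordS v)) :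
  (arrow (uniserial K i l) v x : {ffun _ -> K^o}) j =
  \sum_(k : uniserial_basis i l v | val (val k) == (val (val j)).+1) (x : {ffun _ -> K^o}) k.
Proof.
pose F0 := fun y : {ffun uniserial_basis i l v -> K^o} => [ffun j : uniserial_basis i l (ordS v) =>
          \sum_(k : uniserial_basis i l v | val (val k) == (val (val j)).+1)
            y k].
have linF : linear F0.
  move=> a y z; apply/ffunP => m; rewrite !ffunE scaler_sumr -big_split /=.
  by apply: eq_bigr => k _; rewrite !ffunE.
by rewrite /= (linfun_fun_linear linF) ffunE.
Qed.

Lemma uniserial_nilpotent i l : nilpotent_rep (uniserial K i l).
Proof.
exists l => v; apply/lfunP => x; rewrite zero_lfunE.
have P k : forall j : uniserial_basis i l (iter k (@ordS n.+1) v),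
   (l - k <= val (val j))%N -> (iter_arrow (uniserial K i l) v k x : {ffun _ -> K^o}) j = 0.
  elim: k => [|k IH] j /=.
    by rewrite subn0 leqNgt ltn_ord.
  move=> lj; rewrite lfunE /= uniserial_arrowE big1 // => m /eqP mj.
  by apply: IH; rewrite mj leq_subLR addnS -addSn -leq_subLR.
by apply/ffunP => j; rewrite P ?ffunE // subnn.
Qed.

(* Every nonzero subrepresentation contains a nonzero multiple of e_0. *)
Lemma uniserial_socle i l (U : subspaces (uniserial K i l)) :
  is_subrep U -> (exists v, U v != 0%VS) ->
  exists2 x, x \in U i & 
   (exists j, (x : {ffun uniserial_basis i l i -> K^o}) j != 0 /\ val (val j) = 0%N)
  /\ (forall j, (x : {ffun uniserial_basis i l i -> K^o}) j != 0 -> val (val j) = 0%N).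
Proof.
move=> sU [v nz].
have [x xU x0] : exists2 x, x \in U v & x != 0.
  by exists (vpick (U v)); rewrite ?memv_pick ?vpick0.
have [m []] : exists m : nat, (exists j, (x : {ffun uniserial_basis i l v -> K^o}) j != 0 /\ val (val j) = m)
  /\ (forall j, (x : {ffun uniserial_basis i l v -> K^o}) j != 0 -> (val (val j) <= m)%N).
  have [j0 hj0] : exists j, (x : {ffun uniserial_basis i l v -> K^o}) j != 0.
    apply/existsP; apply: contraNT x0 => /existsPn H; apply/eqP/ffunP => j.
    by rewrite ffunE; apply/eqP; rewrite -[_ == _]negbK H.
  case: (@arg_maxnP _ j0 (fun j => (x : {ffun uniserial_basis i l v -> K^o}) j != 0) (fun j => val (val j)) hj0) => j hj hm.
  by exists (val (val j)); split; [exists j|].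
elim: m v x xU {nz x0} => [|m IH] v x xU [j [hj jm]] hmax.
  have vi : v = i by case: (j) jm => j' /= /eqP jE; move=> j0; move: jE; rewrite j0.
  subst v; exists x => //; split; first by exists j.
  by move=> j' /hmax; rewrite leqn0 => /eqP.
apply: (IH (ordS v) (arrow _ v x)).
- by apply: (subvP (sU v)); apply: memv_img.
- have lm : (m < l)%N by have := ltn_ord (val j); rewrite jm; exact: ltnW.
  have hm : iter (Ordinal lm) (@ordS n.+1) (ordS v) == i.
    by case: (j) jm => j' /= jE jm; rewrite -iterSr -jm.
  exists (exist _ (Ordinal lm) hm); split => //.
  rewrite uniserial_arrowE (bigD1 j) /= ?jm // big1 ?addr0 // => k /andP[/eqP km kj].
  by case/eqP: kj; apply/val_inj/val_inj; apply: etrans (esym jm); exact: km.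
- move=> j'; rewrite uniserial_arrowE; apply: contraR; rewrite -ltnNge => mj.
  rewrite big1 // => k /eqP kE; apply/eqP; apply: contraT => /hmax.
  by rewrite kE ltnS leqNgt mj.
Qed.

Lemma uniserial_dim i l : (\sum_v \dim {:uniserial K i l v})%N = l.
Proof.
transitivity (\sum_(v : 'I_n.+1) #|{: uniserial_basis i l v}|)%N.
  by apply: eq_bigr => v _; rewrite dimvf /dim /= muln1.
transitivity (\sum_(v : 'I_n.+1) \sum_(j : 'I_l) (iter j (@ordS n.+1) v == i))%N.
  by apply: eq_bigr => v _; rewrite /uniserial_basis card_sig -sum1_card big_mkcond /=; apply: eq_bigr => j _; rewrite unfold_in /=; case: eqP.
rewrite exchange_big /= -[RHS]card_ord -sum1_card; apply: eq_bigr => j _.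
have inj : injective (iter j (@ordS n.+1)).
  by elim: (val j) => //= m IH a b /(can_inj (@ordSK _)) /IH.
rewrite (bigD1 (invF inj i)) //= f_invF eqxx big1 // => v; apply: contraNeq.
by rewrite eqb0 negbK => /eqP <-; rewrite invF_f.
Qed.

End RepresentationTheory.

(* Partitions, without trailing zeros. *)
Definition is_partition (s : seq nat) := sorted geq s && (0%N \notin s).
Definition partition_nat := {s : seq nat | is_partition s}.

Definition Pi (n : nat) := {ffun 'I_n.+1 -> partition_nat}.

Definition empty_partition : partition_nat := exist _ [::] isT.
Definition Pi0 n : Pi n := [ffun=> empty_partition].

Definition rep_of (K : fieldType) (n : nat) (p : Pi n) : rep K n :=
  bigdsum (fun i : 'I_n.+1 =>
    bigdsum (fun k : 'I_(size (val (p i))) =>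
      uniserial K i (nth 0%N (val (p i)) k))).

(* The isomorphism class of a nilpotent representation. *)
Definition iso_class (K : fieldType) (n : nat) (M : rep K n) : Pi n :=
  xget (Pi0 n) [set p | isomorphic M (rep_of K p)].

(* The set [A_w] *)
Definition filtered_classes (K : fieldType) (n r : nat) (w : 'I_r -> rep K n) :
    set (Pi n) :=
  [set p | exists M, [/\ nilpotent_rep M, has_filtration w M & iso_class M = p]].

(* F^X_{M N} *)
Definition hall_number (K : finFieldType) (n : nat) (X M N : rep K n) : nat :=
  #|` fset_set [set U : subspaces X |
        [/\ is_subrep U, isomorphic (subrep U) N & isomorphic (quot U) M]] |.

(* f a b c is f^c_{a b} *)
Definition hall_polynomials (n : nat) (f : Pi n -> Pi n -> Pi n -> {poly rat}) :=
  forall (K : finFieldType) (a b c : Pi n) (M N X : rep K n),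
    isomorphic M (rep_of K a) -> isomorphic N (rep_of K b) ->
    isomorphic X (rep_of K c) ->
    (hall_number X M N)%:R = (f a b c).[#|K|%:R].

Definition H0 (n : nat) := {malg rat[Pi n]}.

Section HallAlgebra.
Context (n : nat) (f : Pi n -> Pi n -> Pi n -> {poly rat}).

Definition H0_basis (p : Pi n) : H0 n := << p >>.

(* The sum has finite support, f being a family of Hall polynomials. *)
Definition basis_mul (a b : Pi n) : H0 n :=
  \sum_(c \in [set: Pi n]) (f a b c).[0] *: H0_basis c.

Definition hall_mul (x y : H0 n) : H0 n :=
  \sum_(a <- msupp x) \sum_(b <- msupp y) (x@_a * y@_b) *: basis_mul a b.

End HallAlgebra.

(* Main.v *)
Require Import Defs.
From mathcomp Require Import all_boot all_order all_algebra all_fingroup all_solvable.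
From mathcomp Require Import finmap.
From mathcomp Require Import boolp classical_sets functions cardinality fsbigop.
From mathcomp Require Import monalg zify ring.

(* The path ranks of a representation, i.e. the ranks of the actions of all
   paths, determine a nilpotent representation up to isomorphism.  Let a be the
   class of a semisimple representation of dimension vector d.  A subspace U of
   X with X/U semisimple of dimension vector d is, at each vertex, a subspace
   of prescribed dimension containing the image of the arrow, and its class is
   determined by the relative position of U with respect to the flag of kernels
   of paths.  Over F_p a regular unipotent transformation preserving these
   flags acts on the set of all U of a given class b; it has p-power order and
   fixes only the member U_0 of a complete refined flag.  Hence the Hall number
   is 1 or 0 modulo p, according to whether U_0 has class b, and since this
   condition, in terms of path ranks, does not depend on p, the Hall polynomial
   takes the value 1 or 0 at q = 0.  So multiplication by u_a sends u_b to the
   sum of the u_c for which the greedy subrepresentation U_0 has class b.  On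
   the other side, U_0 has the least path ranks among all U and these ranks are
   monotone in those of X, so having a filtration of type w is inherited by
   degenerations; thus X has a filtration of type (N, w') if and only if U_0
   exists and has one of type w'. *)

Set Implicit Arguments.
Unset Strict Implicit.
Unset Printing Implicit Defensive.

Import GRing.Theory Num.Theory Order.TTheory.

Local Open Scope ring_scope.

(** * Flags and regular unipotent transformations *)

Section Flags.
Context {K : fieldType} {V : vectType K}.
Implicit Types (X : seq V) (U W : {vspace V}) (G : nat -> {vspace V}).

Lemma memvDl U x y : x \in U -> (x + y \in U) = (y \in U).
Proof. exact: rpredDl. Qed.

Lemma memvZ_neq0 U c x : c != 0 -> (c *: x \in U) = (x \in U).
Proof. by move=> c0; rewrite rpredZeq (negPf c0). Qed.

Lemma adapted_basis G L :
  (forall k, (k < L)%N -> (G k <= G k.+1)%VS) ->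
  exists X, [/\ free X, <<X>>%VS = G L &
    forall k, (k <= L)%N -> <<take (\dim (G k)) X>>%VS = G k].
Proof.
elim: L => [|L IH] GS.
  exists (vbasis (G 0%N)); split; first exact: basis_free (vbasisP _).
    exact: span_basis (vbasisP _).
  move=> k; rewrite leqn0 => /eqP->.
  by rewrite take_oversize ?size_tuple // (span_basis (vbasisP _)).
have [|X [fX sX tX]] := IH; first by move=> k kL; apply/GS/ltnW.
have GL := GS L (ltnSn L).
have sumG : (G L + (G L.+1 :\: G L))%VS = G L.+1.
  by rewrite addvC addv_diff; apply/addv_idPl.
have bX : basis_of (G L) X by rewrite /basis_of sX fX eqxx.
have bY : basis_of (G L.+1) (X ++ vbasis (G L.+1 :\: G L)).
  have dG : directv (G L + (G L.+1 :\: G L))%VS.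
    by apply/directv_addP; rewrite capvC capv_diff.
  by have := cat_basis dG bX (vbasisP _); rewrite /= sumG.
exists (X ++ vbasis (G L.+1 :\: G L)); split.
- exact: basis_free bY.
- exact: span_basis bY.
move=> k; rewrite leq_eqVlt ltnS => /orP[/eqP->|kL].
  by rewrite take_oversize ?(span_basis bY) // (size_basis (X := in_tuple _) bY).
have GkL : (G k <= G L)%VS.
  suff H m : (k <= m)%N -> (m <= L)%N -> (G k <= G m)%VS by apply: H.
  elim: m => [|m IHm]; first by rewrite leqn0 => /eqP->.
  rewrite leq_eqVlt ltnS => /orP[/eqP->//|km] mL.
  by apply: subv_trans (IHm km (ltnW mL)) _; apply: GS; apply: ltnW.
rewrite takel_cat ?tX //.
rewrite -[X in (_ <= size X)%N]/(in_tuple X : seq V) size_tuple.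
by rewrite -(size_basis (X := in_tuple X) bX) dimvS.
Qed.

End Flags.

Section RegularUnipotent.
Context {K : fieldType} {V : vectType K} (X : seq V).
Hypothesis (freeX : free X) (spanX : <<X>>%VS = fullv).

Let B j := <<take j X>>%VS.

Lemma flagS j : (j < size X)%N -> B j.+1 = (B j + <[X`_j]>)%VS.
Proof. by move=> jX; rewrite /B (take_nth 0) // -cats1 span_cat span_seq1. Qed.

Lemma flag_subS j : (B j <= B j.+1)%VS.
Proof.
have [jX|Xj] := ltnP j (size X); first by rewrite flagS // addvSl.
by rewrite /B !take_oversize // ltnW.
Qed.

Lemma flag_sub i j : (i <= j)%N -> (B i <= B j)%VS.
Proof.
elim: j => [|j IH]; first by rewrite leqn0 => /eqP->.
rewrite leq_eqVlt => /orP[/eqP->//|ij].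
exact: subv_trans (IH ij) (flag_subS j).
Qed.

Lemma flag_free j : free (take j X).
Proof. by apply: (@catl_free _ _ (drop j X)); rewrite cat_take_drop. Qed.

Lemma dim_flag j : (j <= size X)%N -> \dim (B j) = j.
Proof.
move=> jX; have := flag_free j; rewrite /free => /eqP->.
by rewrite size_takel.
Qed.

Lemma flag_top j : (size X <= j)%N -> B j = fullv.
Proof. by move=> Xj; rewrite /B take_oversize. Qed.

Lemma flag_nth j : (j < size X)%N -> X`_j \in B j.+1 /\ X`_j \notin B j.
Proof.
move=> jX; split; first by rewrite flagS // (subvP (addvSr _ _)) ?memv_line.
have := flag_free j.+1; rewrite (take_nth 0) // -cats1.
by rewrite (perm_free (permEl (perm_catC _ _))) free_cons => /andP[].
Qed.

Lemma flag_decomp j x : (j < size X)%N -> x \in B j.+1 ->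
  exists y c, [/\ y \in B j, x = y + c *: X`_j & (x \in B j) = (c == 0)].
Proof.
move=> jX; rewrite flagS // => /memv_addP[y yB [z /vlineP[c ->] ->]].
exists y, c; split=> //; rewrite memvDl //; have [_ nX] := flag_nth jX.
apply/idP/eqP=> [|->]; last by rewrite scale0r mem0v.
by apply: contraTeq => c0; rewrite memvZ_neq0.
Qed.

Variable N : 'End(V).
Hypothesis (N0 : N X`_0 = 0) (NS : forall i, (i.+1 < size X)%N -> N X`_i.+1 = X`_i).

Lemma shift_flag j x : x \in B j.+1 -> N x \in B j.
Proof.
elim: j x => [|j IH] x.
  have [X0|X0] := ltnP 0 (size X).
    case/(flag_decomp X0) => y [c [yB -> _]].
    move: yB; rewrite /B take0 span_nil memv0 => /eqP->.
    by rewrite add0r linearZ /= N0 scaler0 mem0v.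
  move: X0; rewrite leqn0 size_eq0 => /eqP X0; rewrite /B X0 /= span_nil !memv0.
  by move=> /eqP->; rewrite linear0.
have [jX|Xj] := ltnP j.+1 (size X).
  case/(flag_decomp jX) => y [c [yB -> _]].
  rewrite linearD linearZ /= NS // memvD ?memvZ //.
    exact: (subvP (flag_subS _)) (IH _ yB).
  by have [] := flag_nth (ltnW jX).
move: Xj; rewrite leq_eqVlt => /orP[/eqP Xj|Xj] xB.
  apply: (subvP (flag_subS j)); apply: IH; move: xB.
  by rewrite !flag_top ?Xj.
by rewrite (flag_top (ltnW Xj)) memvf.
Qed.

Lemma shift_flag_notin j x : (j.+1 < size X)%N ->
  x \in B j.+2 -> x \notin B j.+1 -> N x \notin B j.
Proof.
move=> jX /(flag_decomp jX)[y [c [yB -> ->]]] c0.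
rewrite linearD linearZ /= NS // memvDl ?shift_flag // memvZ_neq0 //.
by have [] := flag_nth (ltnW jX).
Qed.

Lemma flag_extend (U : {vspace V}) j x : (j < size X)%N -> (B j <= U)%VS ->
  x \in U -> x \in B j.+1 -> x \notin B j -> (B j.+1 <= U)%VS.
Proof.
move=> jX BU xU xB xnB; have [y [c [yB xE cE]]] := flag_decomp jX xB.
rewrite flagS // subv_add BU /= -memvE.
move: xnB; rewrite cE => c0; move: xU.
by rewrite xE (memvDl _ (subvP BU _ yB)) memvZ_neq0.
Qed.

Lemma shift_stable_contains (U : {vspace V}) j x : (forall y, y \in U -> N y \in U) ->
  (j < size X)%N -> x \in U -> x \in B j.+1 -> x \notin B j -> (B j.+1 <= U)%VS.
Proof.
move=> stU; elim: j x => [|j IH] x jX xU xB xnB.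
  by apply: (flag_extend _ _ xU xB xnB) => //; rewrite /B take0 span_nil sub0v.
apply: (flag_extend _ _ xU xB xnB) => //.
exact: IH (ltnW jX) (stU _ xU) (shift_flag xB) (shift_flag_notin jX xB xnB).
Qed.

Lemma shift_stable_flag (U : {vspace V}) : (forall y, y \in U -> N y \in U) ->
  exists2 j, (j <= size X)%N & U = B j.
Proof.
move=> stU.
suff H j : (j <= size X)%N -> (U <= B j)%VS -> exists2 i, (i <= size X)%N & U = B i.
  by apply: (H (size X)) => //; rewrite flag_top // subvf.
elim: j => [|j IH] jX UB.
  by exists 0%N => //; apply/eqP; rewrite eqEsubv UB /B take0 span_nil sub0v.
have [/IH|/subvPn[x xU xnB]] := boolP (U <= B j)%VS; first by apply; apply: ltnW.
exists j.+1 => //; apply/eqP; rewrite eqEsubv UB.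
by apply: (shift_stable_contains stU jX xU _ xnB); apply: (subvP UB).
Qed.

Let u : 'End(V) := \1%VF + N.

Lemma unipotent_sub j x : x \in B j.+1 -> u x - x \in B j.
Proof. by move=> /shift_flag; rewrite add_lfunE id_lfunE addrAC subrr add0r. Qed.

Lemma unipotent_flag j x : x \in B j -> u x \in B j.
Proof.
move=> xB; rewrite -(subrK x (u x)) memvD //.
by apply/unipotent_sub/(subvP (flag_subS j)).
Qed.

Lemma unipotent_fixed_flag (U : {vspace V}) : (u @: U <= U)%VS ->
  exists2 j, (j <= size X)%N & U = B j.
Proof.
move=> /subvP uU; apply: shift_stable_flag => y yU.
have := uU _ (memv_img u yU); rewrite add_lfunE id_lfunE.
by rewrite memvDl.
Qed.

(* u moves x in B j.+1 by some z in B j, which u ^ (p ^ j) fixes by induction;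
   so the p-th iterate of u ^ (p ^ j) moves x by p z = 0. *)
Lemma iter_unipotent_char (p : nat) j x : p \in [pchar K] -> x \in B j ->
  iter (p ^ j) u x = x.
Proof.
move=> pK; elim: j x => [|j IH] x xB.
  move: xB; rewrite /B take0 span_nil memv0 => /eqP->.
  by rewrite expn0 /= linear0.
have iter_add m y z : iter m u (y + z) = iter m u y + iter m u z.
  by elim: m => //= m ->; rewrite linearD.
have iterB m y : y \in B j -> iter m u y \in B j.
  by move=> yB; elim: m => //= m ?; apply: unipotent_flag.
have iter_sub m : iter m u x - x \in B j.
  elim: m => [|m IHm] /=; first by rewrite subrr mem0v.
  rewrite -(subrKA (iter m u x)) memvD // unipotent_sub //.
  by rewrite -(subrK x (iter m u x)) memvD // (subvP (flag_subS j) _ IHm).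
pose z := iter (p ^ j) u x - x.
have zE m : iter (m * p ^ j) u x = x + z *+ m.
  elim: m => [|m IHm]; first by rewrite mulr0n addr0.
  rewrite mulSn iterD IHm iter_add -[in LHS](subrK x (iter (p ^ j) u x)) -/z.
  have -> : iter (p ^ j) u (z *+ m) = z *+ m by apply/IH/rpredMn/iter_sub.
  by rewrite mulrS addrA (addrC z).
rewrite expnS zE; suff -> : z *+ p = 0 by rewrite addr0.
by rewrite -scaler_nat (pcharf0 pK) scale0r.
Qed.

End RegularUnipotent.

Lemma regular_unipotent (p : nat) (K : fieldType) (V : vectType K) (X : seq V) :
  p \in [pchar K] -> free X -> <<X>>%VS = fullv ->
  exists u : 'End(V), [/\
    forall j x, x \in <<take j X>>%VS -> u x \in <<take j X>>%VS,
    forall U, (u @: U <= U)%VS -> exists2 j, (j <= size X)%N & U = <<take j X>>%VS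
  & forall m x, (size X <= m)%N -> iter (p ^ m) u x = x].
Proof.
move=> pK fX sX.
have [f /(_ fX) fE] := linear_of_free X (take (size X) (0 :: X)).
have NE i : (i < size X)%N -> linfun f X`_i = (0 :: X)`_i.
  move=> iX; rewrite lfunE -[LHS](nth_map _ 0) // fE ?nth_take //.
  by rewrite size_takel.
have N0 : linfun f X`_0 = 0.
  have [/NE//|] := ltnP 0 (size X).
  by rewrite leqn0 size_eq0 => /eqP->; rewrite linear0.
have NS i : (i.+1 < size X)%N -> linfun f X`_i.+1 = X`_i by move/NE.
exists (\1%VF + linfun f); split=> [j x|U|m x Xm].
- exact: unipotent_flag.
- exact: unipotent_fixed_flag.
by apply: (iter_unipotent_char (X := X)) => //; rewrite take_oversize // sX memvf.
Qed.

Section FixedPoints.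
Variables (T : choiceType) (p m : nat) (A : {fset T}) (s : T -> T).
Hypotheses (p_pr : prime p) (sA : {in A, forall x, s x \in A})
  (s_order : {in A, forall x, iter (p ^ m) s x = x}).

Lemma card_fixed_mod : #|` A| = #|` [fset x in A | s x == x]%fset| %[mod p].
Proof.
pose f (x : A) : A := [` sA (valP x)]%fset.
have fE k x : val (iter k f x) = iter k s (val x) by elim: k => //= k ->.
have f_order x : iter (p ^ m) f x = x by apply/val_inj; rewrite fE s_order ?(valP x).
have f_inj : injective f.
  apply: (can_inj (g := iter (p ^ m).-1 f)) => x.
  by rewrite -iterSr prednK ?f_order // expn_gt0 prime_gt0.
pose g := perm f_inj.
have gE k x : (g ^+ k)%g x = iter k f x.
  by elim: k x => [|k IH] x; rewrite ?expg0 ?perm1 // expgSr permM IH permE.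
have gp : (p.-group <[g]>)%g.
  have : (g ^+ (p ^ m) = 1)%g by apply/permP => x; rewrite gE f_order perm1.
  move/eqP; rewrite -order_dvdn => d; rewrite /pgroup -orderE.
  by apply: pnat_dvd d _; rewrite pnatX pnat_id.
have acts : [acts <[g]>, on [set: A] | 'P]%g.
  by apply/actsP => x _ y; rewrite !inE.
have := pgroup_fix_mod gp acts; rewrite cardsT -cardfE => ->.
congr (_ %% _)%N.
have fixE y : (y \in 'Fix_([set: A] | 'P)(<[g]>)%g) = (s (val y) == val y).
  rewrite finset.inE finset.in_setT afix_cycle ?finset.in_setT //.
  have -> : (s (val y) == val y) = (g y == y) by rewrite permE.
  by apply/afix1P/eqP.
have -> : [fset x in A | s x == x]%fset =
    [fset val x | x in 'Fix_([set: A] | 'P)(<[g]>)%g]%fset.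
  apply/fsetP => x; apply/idP/imfsetP => /= [|[y yF ->]].
    by rewrite !inE => /andP[xA sx]; exists [` xA]%fset; rewrite ?fixE.
  by rewrite !inE -fixE yF andbT; apply: valP.
by rewrite card_imfset -?cardE //; apply: val_inj.
Qed.

End FixedPoints.

Lemma horner_mod_constant (q : {poly int}) (p : nat) :
  (p%:Z %| q.[p%:Z] - q.[0])%Z.
Proof.
elim/poly_ind: q => [|q c _]; first by rewrite !horner0 subrr dvdz0.
by rewrite !hornerMXaddC mulr0 add0r addrK dvdz_mull.
Qed.

Lemma horner0_of_mod (P : {poly rat}) (h : nat -> nat) (e : nat) :
  (forall p, prime p -> (h p)%:R = P.[p%:R] /\ h p = e %[mod p]) ->
  P.[0] = e%:R.
Proof.
move=> hP; have [q [a a0 PE]] := rat_poly_scale P.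
have aP (x : int) : q.[x]%:~R = a%:~R * P.[x%:~R].
  rewrite PE hornerZ mulrA mulfV ?intr_eq0 // mul1r.
  by rewrite horner_map.
have q0 : q.[0] = a * e%:Z.
  apply/eqP; rewrite -subr_eq0 -absz_eq0.
  set N := `|_|%N.
  have [p pN p_pr] := prime_above N.
  have [hp he] := hP _ p_pr.
  have dN : (p %| N)%N.
    have -> : (p %| N)%N = (p%:Z %| q.[0] - a * e%:Z)%Z by [].
    have qp : q.[p%:Z] = a * (h p)%:Z.
      by apply: (@intr_inj rat); rewrite aP rmorphM /= -hp.
    have d1 := horner_mod_constant q p.
    have d2 : (p%:Z %| (h p)%:Z - e%:Z)%Z.
      by rewrite -eqz_mod_dvd !modz_nat eqz_nat; apply/eqP.
    have -> : q.[0] - a * e%:Z = a * ((h p)%:Z - e%:Z) - (q.[p%:Z] - q.[0]).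
      by rewrite qp mulrBr; ring.
    by rewrite rpredB // dvdz_mull.
  by have := dvdn_leq _ dN; case: (N) pN => // m pm /(_ isT); rewrite leqNgt pm.
apply: (mulfI (x := a%:~R)); first by rewrite intr_eq0.
by rewrite -(aP 0) q0 rmorphM.
Qed.

(** * Kernels of paths *)

Section Unshift.
Context {n : nat} {T : 'I_n.+1 -> Type}.

(* ordS (ord_pred v) = v holds only propositionally, so a family given at the
   vertices ordS u is turned into a family on all vertices by transport. *)
Definition unshift (y : forall u, T (ordS u)) v : T v :=
  ecast u (T u) (ord_predK v) (y (ord_pred v)).

Lemma unshiftE y u : unshift y (ordS u) = y u.
Proof.
rewrite /unshift; move: (ord_predK (ordS u)) (ordSK u).
by move: (ord_pred _) => w e wu; case: _ / wu e => e; rewrite eq_axiomK.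
Qed.

End Unshift.

Lemma ordS_ind n (P : 'I_n.+1 -> Prop) : (forall u, P (ordS u)) -> forall v, P v.
Proof. by move=> PS v; rewrite -[v]ord_predK. Qed.

Lemma dim_pair_sub (K : fieldType) (V W : vectType K) (A : {vspace V})
    (B : {vspace W}) (C : {vspace (V * W)%type}) :
  (forall x, (x \in C) = (x.1 \in A) && (x.2 \in B)) ->
  \dim C = (\dim A + \dim B)%N.
Proof.
move=> CE.
have lin1 : linear (fst : V * W -> V) by [].
have lin2 : linear (fun y : W => (0, y) : V * W).
  by move=> a x y; congr (_, _); rewrite /= scaler0 addr0.
rewrite -(limg_ker_dim (linfun (fst : V * W -> V)) C) addnC; congr addn.
  congr (\dim _); apply/vspaceP => x; apply/memv_imgP/idP => [[y + ->]|xA].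
    by rewrite CE linfun_fun_linear // => /andP[].
  by exists (x, 0); rewrite ?CE ?xA ?mem0v ?linfun_fun_linear.
rewrite -(limg_dim_eq (f := linfun (fun y : W => (0, y) : V * W)) (U := B)).
  congr (\dim _); apply/vspaceP => -[x y]; rewrite memv_cap memv_ker CE /=.
  rewrite linfun_fun_linear //=; apply/andP/memv_imgP => /=.
    by case=> /andP[_ yB] /eqP->; exists y; rewrite ?linfun_fun_linear.
  by case=> z zB; rewrite linfun_fun_linear // => -[-> ->]; rewrite mem0v zB eqxx.
apply/eqP; rewrite -subv0; apply/subvP => y; rewrite memv_cap memv_ker.
by rewrite linfun_fun_linear // => /andP[_ /eqP[->]]; rewrite mem0v.
Qed.

Lemma dim_supported (K : fieldType) (I : finType) (P : pred I)
    (C : {vspace {ffun I -> K^o}}) :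
  (forall x, x \in C <-> (forall j, ~~ P j -> (x : {ffun I -> K^o}) j = 0)) ->
  \dim C = #|P|.
Proof.
move=> CE.
pose ext (y : {ffun {j | P j} -> K^o}) : {ffun I -> K^o} :=
  [ffun j => if insub j is Some j' then y j' else 0].
have extE y j (Pj : P j) : ext y j = y (exist _ j Pj) by rewrite ffunE insubT.
have ext0 y j : ~~ P j -> ext y j = 0 by move=> Pj; rewrite ffunE insubN.
have lin_ext : linear ext.
  move=> a x y; apply/ffunP => j; rewrite !ffunE.
  by case: insubP => [u _ _|_]; rewrite ?ffunE // scaler0 addr0.
have -> : C = limg (linfun ext).
  apply/vspaceP => x; apply/idP/memv_imgP => [/CE xC|[y _ ->]].
    exists [ffun j => (x : {ffun I -> K^o}) (val j)]; rewrite ?memvf //.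
    rewrite linfun_fun_linear //; apply/ffunP => j.
    by have [Pj|Pj] := boolP (P j); rewrite ?(extE _ _ Pj) ?ext0 ?ffunE // xC.
  by rewrite linfun_fun_linear //; apply/CE => j; apply: ext0.
rewrite limg_dim_eq ?dimvf /dim /= ?muln1 ?card_sig //.
apply/eqP; rewrite -subv0; apply/subvP => y; rewrite memv_cap memv_ker memv0.
rewrite linfun_fun_linear // => /andP[_ /eqP/ffunP y0]; apply/eqP/ffunP => -[j Pj].
by rewrite -extE y0 !ffunE.
Qed.

Section PathKernels.
Context {K : fieldType} {n : nat}.
Implicit Types (M N : rep K n) (v i u : 'I_n.+1).

(* The kernel of the action of the path of length k starting at v; recursing
   through preimages along the first arrow avoids transports between vertices. *)
Fixpoint path_ker M k v : {vspace M v} :=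
  if k is k'.+1 then (arrow M v @^-1: path_ker M k' (ordS v))%VS else 0%VS.

Lemma mem_path_kerS M k v x :
  (x \in path_ker M k.+1 v) = (arrow M v x \in path_ker M k (ordS v)).
Proof. by rewrite memv_preim. Qed.

Lemma path_kerS M k v : (path_ker M k v <= path_ker M k.+1 v)%VS.
Proof.
elim: k v => [|k IH] v; first exact: sub0v.
apply/subvP => x; rewrite mem_path_kerS [in X in _ -> X]mem_path_kerS.
exact/subvP.
Qed.

Lemma path_ker_sub M k m v : (k <= m)%N -> (path_ker M k v <= path_ker M m v)%VS.
Proof.
elim: m => [|m IH]; first by rewrite leqn0 => /eqP->.
rewrite leq_eqVlt ltnS => /orP[/eqP->//|/IH km].
exact: subv_trans km (path_kerS _ _ _).
Qed.

Lemma path_kerE M k v : path_ker M k v = lker (iter_arrow M v k).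
Proof.
rewrite -[RHS]lpreim0 -[0%VS]/(path_ker M 0 _) -[k in LHS]addn0.
elim: k 0%N => [|k IH] m.
  by apply/vspaceP => x; rewrite -memv_preim id_lfunE.
rewrite addSnnS IH /=; apply/vspaceP => x.
by rewrite -!memv_preim comp_lfunE.
Qed.

Lemma nilpotent_path_ker M :
  nilpotent_rep M <-> exists k, forall v, path_ker M k v = fullv.
Proof.
split=> -[k kM]; exists k => v.
  by rewrite path_kerE kM; apply/vspaceP => x; rewrite memv_ker zero_lfunE eqxx memvf.
apply/lfunP => x; rewrite zero_lfunE; apply/eqP.
by rewrite -memv_ker -path_kerE kM memvf.
Qed.

Lemma path_ker_morph M N (g : forall v, 'Hom(M v, N v)) k v x :
  (forall v x, g (ordS v) (arrow M v x) = arrow N v (g v x)) ->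
  (forall v, injective (g v)) ->
  (g v x \in path_ker N k v) = (x \in path_ker M k v).
Proof.
move=> gM g_inj; elim: k v x => [|k IH] v x.
  by rewrite !memv0 -(inj_eq (g_inj v)) linear0.
by rewrite !mem_path_kerS -gM IH.
Qed.

Lemma isomorphic_fun M N (g : forall v, M v -> N v) :
  (forall v, linear (g v)) -> (forall v, bijective (g v)) ->
  (forall v x, g (ordS v) (arrow M v x) = arrow N v (g v x)) -> isomorphic M N.
Proof.
move=> lin_g bij_g gM; exists (fun v => linfun (g v)).
have gE v : linfun (g v) =1 g v by apply: linfun_fun_linear.
split=> v; first exact: eq_bij (bij_g v) _ (fsym (gE v)).
by apply/lfunP => x; rewrite !comp_lfunE !gE gM.
Qed.

Lemma isomorphicE M N : isomorphic M N ->
  exists g : forall v, 'Hom(M v, N v), (forall v, bijective (g v)) /\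
    (forall v x, g (ordS v) (arrow M v x) = arrow N v (g v x)).
Proof. by case=> g [bg gM]; exists g; split=> // v x; rewrite -!comp_lfunE gM. Qed.

Lemma lker_inj (V W : vectType K) (f : 'Hom(V, W)) U :
  injective f -> (U :&: lker f = 0)%VS.
Proof. by move/lker0P/eqP->; rewrite capv0. Qed.

Lemma isomorphic_refl M : isomorphic M M.
Proof.
apply: (isomorphic_fun (g := fun v x => x)) => // v.
by exists id.
Qed.

Lemma isomorphic_trans M N X : isomorphic M N -> isomorphic N X -> isomorphic M X.
Proof.
move=> /isomorphicE[g [bg gM]] /isomorphicE[h [bh hM]].
apply: (isomorphic_fun (g := fun v => h v \o g v)) => [v a x y|v|v x] /=.
- by rewrite !linearP.
- exact: (bij_comp (bh v) (bg v)).
by rewrite gM hM.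
Qed.

Lemma isomorphic_sym M N : isomorphic M N -> isomorphic N M.
Proof.
move=> /isomorphicE[g [bg gM]].
have g0 v : lker (g v) == 0%VS by apply/lker0P/bij_inj.
have gK v : cancel (g v)^-1%VF (g v).
  by apply/(bij_can_sym (bg v)); apply: lker0_lfunK.
apply: (isomorphic_fun (g := fun v => (g v)^-1%VF)) => [v a x y|v|v x].
- by rewrite linearP.
- by exists (g v) => //; apply: lker0_lfunK.
by apply: (bij_inj (bg _)); rewrite gK gM gK.
Qed.

Lemma path_ker_dim_iso M N k v : isomorphic M N ->
  \dim (path_ker M k v) = \dim (path_ker N k v).
Proof.
move=> /isomorphicE[g [bg gM]].
have g_inj v' : injective (g v') by apply: bij_inj.
rewrite -(limg_dim_eq (f := g v)) ?lker_inj //.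
congr (\dim _); apply/vspaceP => y.
apply/memv_imgP/idP => [[x xM ->]|yN]; first by rewrite path_ker_morph.
have [h gh hg] := bg v.
by exists (h y); rewrite ?hg // -(path_ker_morph _ _ gM g_inj) hg.
Qed.

Lemma iso_dim M N v : isomorphic M N -> \dim {:M v} = \dim {:N v}.
Proof.
have le M' N' : isomorphic M' N' -> (\dim {:M' v} <= \dim {:N' v})%N.
  move=> /isomorphicE[g [/(_ v)/bij_inj g_inj _]].
  by rewrite -(limg_dim_eq (f := g v)) ?dimvS ?subvf // lker_inj.
by move=> iMN; apply/eqP; rewrite eqn_leq (le _ _ iMN) (le _ _ (isomorphic_sym iMN)).
Qed.

Lemma nilpotent_iso M N : isomorphic M N -> nilpotent_rep M -> nilpotent_rep N.
Proof.
move=> iMN /nilpotent_path_ker[k kM]; apply/nilpotent_path_ker; exists k => v.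
apply/eqP; rewrite eqEdim subvf -(path_ker_dim_iso k v iMN) kM.
by rewrite (iso_dim v iMN) leqnn.
Qed.

Lemma dsum_arrowE M N v (x : dsum M N v) :
  arrow (dsum M N) v x = (arrow M v x.1, arrow N v x.2).
Proof.
by rewrite /= linfun_fun_linear // => a y z; congr (_, _); rewrite /= linearP.
Qed.

Lemma mem_path_ker_dsum M N k v (x : dsum M N v) :
  (x \in path_ker (dsum M N) k v) =
  (x.1 \in path_ker M k v) && (x.2 \in path_ker N k v).
Proof.
elim: k v x => [|k IH] v x; first by rewrite !memv0; case: x.
by rewrite !mem_path_kerS IH dsum_arrowE.
Qed.

Lemma path_ker_dim_dsum M N k v :
  \dim (path_ker (dsum M N) k v) =
  (\dim (path_ker M k v) + \dim (path_ker N k v))%N.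
Proof. by apply: dim_pair_sub => x; apply: mem_path_ker_dsum. Qed.

Lemma nilpotent_dsum M N :
  nilpotent_rep (dsum M N) <-> nilpotent_rep M /\ nilpotent_rep N.
Proof.
split=> [/nilpotent_path_ker[k kMN]|[/nilpotent_path_ker[k kM] /nilpotent_path_ker[m mN]]].
  split; apply/nilpotent_path_ker; exists k => v; apply/vspaceP => x; rewrite memvf.
    by have := mem_path_ker_dsum k (x, 0 : N v); rewrite kMN memvf => /esym/andP[].
  by have := mem_path_ker_dsum k (0 : M v, x); rewrite kMN memvf => /esym/andP[].
apply/nilpotent_path_ker; exists (maxn k m) => v; apply/vspaceP => x.
rewrite memvf mem_path_ker_dsum.
by rewrite (subvP (path_ker_sub _ _ (leq_maxl k m))) ?kM ?memvf //
  (subvP (path_ker_sub _ _ (leq_maxr k m))) ?mN ?memvf.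
Qed.

Lemma mem_path_ker_uniserial i l k v (x : uniserial K i l v) :
  x \in path_ker (uniserial K i l) k v <->
  forall j : uniserial_basis i l v, (k <= val (val j))%N ->
    (x : {ffun uniserial_basis i l v -> K^o}) j = 0.
Proof.
elim: k v x => [|k IH] v x.
  rewrite memv0; split=> [/eqP-> j _|x0]; first by rewrite ffunE.
  by apply/eqP/ffunP => j; rewrite x0 // ffunE.
rewrite mem_path_kerS IH; split=> xk j kj; last first.
  rewrite uniserial_arrowE big1 // => m /eqP mj.
  by rewrite xk // mj ltnS.
case: j kj => -[[|j] jl] /= ji // kj; have jl' := ltnW jl.
have ji' : iter (Ordinal jl') (@ordS n.+1) (ordS v) == i by rewrite -iterSr.
have := xk (exist _ (Ordinal jl') ji') kj.
rewrite uniserial_arrowE (bigD1 (exist _ (Ordinal jl) ji)) //= big1 ?addr0 //.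
by move=> m /andP[/eqP mj]; case/eqP; apply/val_inj/val_inj.
Qed.

End PathKernels.

(** * Uniserial summands *)

Section Uniserial.
Context {K : fieldType} {n : nat}.
Implicit Types (M N : rep K n) (v i u : 'I_n.+1).

Definition uniserial_ker_dim i l k v : nat :=
  \sum_(j < k) ((j < l)%N && (iter j (@ordS n.+1) v == i)).

Lemma path_ker_dim_uniserial i l k v :
  \dim (path_ker (uniserial K i l) k v) = uniserial_ker_dim i l k v.
Proof.
rewrite (@dim_supported _ _ (fun j : uniserial_basis i l v => val (val j) < k)%N);
  last first.
  move=> x; rewrite mem_path_ker_uniserial.
  by split=> xk j kj; apply: xk; move: kj; rewrite -leqNgt.
transitivity (\sum_(j < l) ((j < k)%N && (iter j (@ordS n.+1) v == i)))%N.
  rewrite -(fintype.card_image val_inj) -sum1_card big_mkcond /=; apply: eq_bigr => j _.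
  have -> : (j \in fintype.image val (fun j : uniserial_basis i l v => val (val j) < k)%N) =
    (j < k)%N && (iter j (@ordS n.+1) v == i).
    apply/fintype.imageP/andP => [[[j' ji] jk ->]|[jk ji]]; first by split.
    by exists (exist _ j ji).
  by case: ifP.
pose F j := nat_of_bool (iter j (@ordS n.+1) v == i).
transitivity (\sum_(j < l | (j < k)%N) F j)%N.
  by rewrite [RHS]big_mkcond; apply: eq_bigr => j _; case: ltnP.
transitivity (\sum_(j < k | (j < l)%N) F j)%N.
  by rewrite (@big_ord_widen_cond _ _ _ l (maxn l k) (fun j => (j < k)%N) F) ?leq_maxl //
    (@big_ord_widen_cond _ _ _ k (maxn l k) (fun j => (j < l)%N) F) ?leq_maxr //;
    apply: eq_bigl => j; rewrite andbC.
by rewrite /uniserial_ker_dim big_mkcond; apply: eq_bigr => j _; case: ltnP.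
Qed.

Lemma uniserial_ker_dimS i l k v : uniserial_ker_dim i l k.+1 v =
  (uniserial_ker_dim i l k v + ((k < l)%N && (iter k (@ordS n.+1) v == i)))%N.
Proof. exact: big_ord_recr. Qed.

Lemma subrep_arrowE M (U : subspaces M) v (x : subrep U v) : is_subrep U ->
  vsval (arrow (subrep U) v x) = arrow M v (vsval x).
Proof.
move=> sU; rewrite /= linfun_fun_linear; last by move=> a y z; rewrite !linearP.
by rewrite vsprojK // (subvP (sU v)) // memv_img // subvsP.
Qed.

Lemma split_summand (S M : rep K n) (f : forall v, S v -> M v) (g : forall v, M v -> S v) :
  (forall v, linear (f v)) -> (forall v, linear (g v)) ->
  (forall v x, f (ordS v) (arrow S v x) = arrow M v (f v x)) ->
  (forall v x, g (ordS v) (arrow M v x) = arrow S v (g v x)) ->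
  (forall v x, g v (f v x) = 0 -> x = 0) ->
  exists N, isomorphic M (dsum S N).
Proof.
move=> lf lg fA gA gf0.
have lfE v : linfun (f v) =1 f v by apply: linfun_fun_linear.
have lgE v : linfun (g v) =1 g v by apply: linfun_fun_linear.
pose U : subspaces M := fun v => lker (linfun (g v)).
have memU v x : (x \in U v) = (g v x == 0) by rewrite memv_ker lgE.
have sU : is_subrep U.
  move=> v; apply/subvP => _ /memv_imgP[x xU ->].
  by move: xU; rewrite !memU gA => /eqP->; rewrite linear0.
exists (subrep U); apply: isomorphic_sym.
pose h v := (linfun (g v) \o linfun (f v))%VF.
have hE v x : h v x = g v (f v x) by rewrite comp_lfunE lfE lgE.
have h0 v : lker (h v) == 0%VS.
  rewrite -subv0; apply/subvP => x; rewrite memv_ker hE memv0 => /eqP/gf0->.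
  exact: eqxx.
pose s v y := (h v)^-1%VF (g v y).
have gfs v y : g v (f v (s v y)) = g v y by rewrite -hE lker0_lfunVK.
have ysU v y : y - f v (s v y) \in U v.
  by rewrite memU -lgE linearB /= !lgE gfs subrr.
apply: (isomorphic_fun (g := fun v (x : dsum S (subrep U) v) => f v x.1 + vsval x.2)).
- move=> v a x y; rewrite /= (lf v a x.1 y.1) scalerDr -!addrA.
  by congr (_ + _); rewrite addrCA.
- move=> v; exists (fun y => (s v y, vsproj (U v) (y - f v (s v y)))) => [[x k]|y] /=.
    have gk : g v (vsval k) = 0 by apply/eqP; rewrite -memU subvsP.
    have -> : s v (f v x + vsval k) = x.
      rewrite /s -lgE linearD /= !lgE gk addr0 -hE lker0_lfunK //.
    by rewrite addrAC subrr add0r vsvalK.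
  by rewrite vsprojK ?ysU // addrC subrK.
by move=> v x; rewrite dsum_arrowE /= subrep_arrowE //= fA linearD.
Qed.

Definition push M (x : forall u, M u) : forall u, M u :=
  unshift (fun u => arrow M u (x u)).

Lemma pushE M (x : forall u, M u) u : push x (ordS u) = arrow M u (x u).
Proof. exact: unshiftE. Qed.

Lemma push_path_ker M (x : forall u, M u) k m :
  (forall u, iter k (@push M) x u \in path_ker M m u) <->
  (forall u, x u \in path_ker M (k + m) u).
Proof.
elim: k m => [|k IH] m //; rewrite addSnnS -IH.
split=> xk; last by apply: ordS_ind => u; rewrite iterS pushE -mem_path_kerS.
by move=> u; rewrite mem_path_kerS -pushE; apply: (xk (ordS u)).
Qed.

Lemma exists_functional (V : vectType K) (z : V) :
  z != 0 -> exists f : 'Hom(V, K^o), f z != 0.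
Proof.
move=> z0; apply: contrapT => /forallNP nf; case/eqP: z0.
rewrite (coord_vbasis (memvf z)) big1 // => j _.
have := nf (linfun (coord (vbasis fullv) j : V -> K^o)).
rewrite linfun_fun_linear => [/negP|a x y]; last by rewrite linearP.
by rewrite negbK => /eqP->; rewrite scale0r.
Qed.

(* A vector x0 on which a path of maximal length acts nontrivially generates a
   uniserial subrepresentation f; a functional phi0 that does not vanish on its
   socle extends to a morphism g to the same uniserial representation, and
   g f is injective because it is so on the socle. *)
Lemma split_uniserial M : nilpotent_rep M -> (exists v, {:M v}%VS != 0%VS) ->
  exists i l N, (0 < l)%N /\ isomorphic M (dsum (uniserial K i l) N).
Proof.
move=> nM [v0 M0].
have exL : exists k, `[<forall v, path_ker M k v = fullv>].
  by have /nilpotent_path_ker[k kM] := nM; exists k; apply/asboolP.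
case: (ex_minnP exL) => -[|L] /asboolP kerL minL.
  by case/eqP: M0; rewrite -kerL.
have [v [x0 _ x0L]] : exists v, exists2 x, x \in {:M v}%VS & x \notin path_ker M L v.
  apply: contrapT => /forallNP H.
  suff : (L.+1 <= L)%N by rewrite ltnn.
  apply: minL; apply/asboolP => v; apply/eqP; rewrite eqEsubv subvf.
  by apply/negPn/negP => /subvPn; apply: H.
pose x := dfwith (fun u => 0 : M u) x0.
have [i xi] : exists i, iter L (@push M) x i != 0.
  apply: contrapT => /forallNP H.
  have [/(_ _ v)] := push_path_ker x L 0.
  rewrite addn0 {2}/x dfwith_in (negPf x0L) => xf; suff: false by []; apply: xf => u.
  by rewrite memv0; apply/negPn/negP.
have [phi0 phi0i] := exists_functional xi.
pose phi k := iter k (fun (f : forall u, 'Hom(M u, K^o)) u => (f (ordS u) \o arrow M u)%VF)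
   (dfwith (fun u => 0 : 'Hom(M u, K^o)) phi0).
have phiS j u y : phi j.+1 u y = phi j (ordS u) (arrow M u y) by rewrite comp_lfunE.
have phi_ker j u y : y \in path_ker M j u -> phi j u y = 0.
  elim: j u y => [|j IH] u y; first by rewrite memv0 => /eqP->; rewrite linear0.
  by rewrite mem_path_kerS phiS => /IH.
have pushL u : iter L.+1 (@push M) x u = 0.
  apply/eqP; rewrite -memv0 -[0%VS]/(path_ker M 0 u).
  by move: u; apply/push_path_ker => u; rewrite addn0 kerL memvf.
exists i, L.+1.
pose S := uniserial K i L.+1.
pose g u (y : M u) : S u := [ffun j : uniserial_basis i L.+1 u => phi (val (val j)) u y].
pose f u (s : S u) : M u :=
  \sum_j (s : {ffun uniserial_basis i L.+1 u -> K^o}) j *: iter (L - val (val j)) (@push M) x u.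
have lf u : linear (f u).
  move=> a s t; rewrite scaler_sumr -big_split; apply: eq_bigr => j _.
  by rewrite !ffunE scalerDl scalerA.
have lg u : linear (g u).
  by move=> a s t; apply/ffunP => j; rewrite !ffunE linearP.
have fA u s : f (ordS u) (arrow S u s) = arrow M u (f u s).
  rewrite /f linear_sum /=.
  under eq_bigr => j _ do rewrite uniserial_arrowE scaler_suml.
  rewrite (exchange_big_dep xpredT) //=; apply: eq_bigr => k _.
  rewrite linearZ /= -pushE -iterS.
  case: k => -[[|k] kL] /= ki.
    by rewrite subn0 big1 // -iterS pushL scaler0.
  have kL' := ltnW kL.
  have ki' : iter (Ordinal kL') (@ordS n.+1) (ordS u) == i by rewrite -iterSr.
  rewrite (bigD1 (exist _ (Ordinal kL') ki')) //= big1 ?addr0 => [|j].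
    by rewrite -iterS -subSn // ltnW.
  case/andP => /eqP[kj]; case/eqP.
  by apply/val_inj/val_inj.
have gA u y : g (ordS u) (arrow M u y) = arrow S u (g u y).
  apply/ffunP => j; rewrite uniserial_arrowE ffunE -phiS.
  have := ltn_ord (val j); rewrite ltnS leq_eqVlt => /orP[/eqP jL|jL].
    have -> : phi (val (val j)).+1 u y = 0 
      by apply: phi_ker; rewrite (_ : val (val j) = L) ?kerL ?memvf.
    rewrite big1 // => k /eqP kj; have := ltn_ord (val k).
    by rewrite [X in (X < _)%N](etrans kj (congr1 succn jL)) ltnn.
  have {}jL : ((val (val j)).+1 < L.+1)%N by rewrite ltnS.
  have ji : iter (Ordinal jL) (@ordS n.+1) u == i.
    by rewrite /= -iterS iterSr; apply: (svalP j).
  rewrite (bigD1 (exist _ (Ordinal jL) ji)) //= big1 ?addr0 ?ffunE // => k /andP[/eqP kj].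
  by case/eqP; apply/val_inj/val_inj.
pose h u := (linfun (g u) \o linfun (f u))%VF.
have hE u s : h u s = g u (f u s) by rewrite comp_lfunE !linfun_fun_linear.
have h_mem u s : (s \in lker (h u)) = (g u (f u s) == 0) by rewrite memv_ker hE.
suff gf0 u s : g u (f u s) = 0 -> s = 0.
  by have [N iN] := split_summand lf lg fA gA gf0; exists N.
have sH : is_subrep (fun u => lker (h u) : {vspace S u}).
  move=> w; apply/subvP => _ /memv_imgP[t tH ->].
  by move: tH; rewrite !h_mem fA gA => /eqP->; rewrite linear0.
have [H0|/existsNP[w Hw]] := pselect (forall w, lker (h w) = 0%VS).
  by move/eqP; rewrite -h_mem H0 memv0 => /eqP.
have [t tH [[j [tj j0]] t0]] : exists2 t, t \in lker (h i) &
   (exists j, (t : {ffun uniserial_basis i L.+1 i -> K^o}) j != 0 /\ val (val j) = 0%N)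
  /\ (forall j, (t : {ffun uniserial_basis i L.+1 i -> K^o}) j != 0 -> val (val j) = 0%N).
  by apply: (uniserial_socle sH); exists w; apply/eqP.
case/eqP: tj; move: tH; rewrite h_mem => /eqP/ffunP/(_ j).
rewrite !ffunE j0 /= dfwith_in /f (bigD1 j) //= big1 ?addr0 => [|k kj].
  rewrite j0 subn0 linearZ /= => /eqP; rewrite scaler_eq0 (negPf phi0i) orbF.
  by move/eqP.
have [->|/t0 k0] := eqVneq (t k) 0; first by rewrite scale0r.
by case/eqP: kj; apply/val_inj/val_inj; rewrite /= k0.
Qed.
End Uniserial.

(** * Classification of nilpotent representations *)

Section ZeroArrows.
Context {K : fieldType} {n : nat}.
Implicit Types (M N : rep K n) (v i u : 'I_n.+1).

Definition arrows_zero M := forall v x, arrow M v x = 0.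

Lemma vect_bij_of_dim (V W : vectType K) : \dim {:V} = \dim {:W} ->
  exists g : V -> W, linear g /\ bijective g.
Proof.
move=> dVW.
have [c [lc [c' cK c'K]]] :
    exists c : 'rV[K]_(\dim {:V}) -> 'rV[K]_(\dim {:W}), linear c /\ bijective c.
  by case: _ / dVW; exists id; split=> //; exists id.
have bV := vbasisP {:V}; have bW := vbasisP {:W}.
exists (fun x => passmx.vecof (vbasis {:W}) (c (passmx.rVof (vbasis {:V}) x))).
split; first by move=> a x y; rewrite passmx.rVof_linear lc passmx.vecof_linear.
exists (fun y => passmx.vecof (vbasis {:V}) (c' (passmx.rVof (vbasis {:W}) y))) => x.
  by rewrite passmx.vecofK // cK passmx.rVofK.
by rewrite passmx.vecofK // c'K passmx.rVofK.
Qed.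

Lemma arrows_zero_iso M N : arrows_zero M -> arrows_zero N ->
  (forall v, \dim {:M v} = \dim {:N v}) -> isomorphic M N.
Proof.
move=> M0 N0 dMN.
pose g v := sval (cid (vect_bij_of_dim (dMN v))).
have gP v : linear (g v) /\ bijective (g v) := svalP (cid (vect_bij_of_dim (dMN v))).
apply: (isomorphic_fun (g := g)) => [v|v|v x]; try by have [] := gP v.
have [lg _] := gP (ordS v).
by rewrite M0 N0 -(linfun_fun_linear lg) linear0.
Qed.

Lemma iso_arrows_zero M N : isomorphic M N -> arrows_zero M -> arrows_zero N.
Proof.
move=> /isomorphicE[g [bg gA]] M0 v y.
have [h _ hK] := bg v; by rewrite -(hK y) -gA M0 linear0.
Qed.

Lemma simple_nilpotent_arrows_zero M :
  simple_rep M -> nilpotent_rep M -> arrows_zero M.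
Proof.
move=> [[v0 M0] simM] /nilpotent_path_ker[k kM].
have [|K0|Kf] := simM (path_ker M 1); last first.
- by move=> v x; apply/eqP; rewrite -memv0 -[0%VS]/(path_ker M 0 _) -mem_path_kerS Kf memvf.
- have kM0 m v : path_ker M m v = 0%VS.
    elim: m v => //= m IH v; rewrite IH.
    exact: K0.
  by case/eqP: M0; rewrite -(kM v0) kM0.
move=> v; apply/subvP => _ /memv_imgP[x xK ->].
by move: xK; rewrite mem_path_kerS memv0 => /eqP->; rewrite mem0v.
Qed.

Lemma semisimple_nilpotent_arrows_zero M :
  semisimple_rep M -> nilpotent_rep M -> arrows_zero M.
Proof.
move=> [m [F [simF iMF]]] nM; apply: iso_arrows_zero (isomorphic_sym iMF) _.
move: (nilpotent_iso iMF nM); elim: m F simF {iMF} => [|m IH] F simF /=.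
  by move=> _ v x; rewrite [arrow _ _]/= zero_lfunE.
case/nilpotent_dsum => nF0 nF v x; rewrite dsum_arrowE.
rewrite (simple_nilpotent_arrows_zero (simF _) nF0).
by rewrite (IH (fun j => F (lift ord0 j)) (fun j => simF _) nF).
Qed.

End ZeroArrows.

Section Classification.
Context {K : fieldType} {n : nat}.
Implicit Types (M N : rep K n) (v i u : 'I_n.+1) (s : seq ('I_n.+1 * nat)).

Lemma dsum_iso M M' N N' : isomorphic M M' -> isomorphic N N' ->
  isomorphic (dsum M N) (dsum M' N').
Proof.
move=> /isomorphicE[g [bg gA]] /isomorphicE[h [bh hA]].
apply: (isomorphic_fun (g := fun v (x : dsum M N v) => (g v x.1, h v x.2) : dsum M' N' v)).
- by move=> v a x y; rewrite !linearP.
- move=> v; have [g' gK g'K] := bg v; have [h' hK h'K] := bh v.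
  by exists (fun y => (g' y.1, h' y.2)) => -[x y] /=; rewrite ?gK ?hK ?g'K ?h'K.
by move=> v x; rewrite !dsum_arrowE /= gA hA.
Qed.

Lemma dsumCA M N X : isomorphic (dsum M (dsum N X)) (dsum N (dsum M X)).
Proof.
apply: (isomorphic_fun (g := fun v (x : dsum M (dsum N X) v) =>
  (x.2.1, (x.1, x.2.2)) : dsum N (dsum M X) v)) => //.
- by move=> v; exists (fun x => (x.2.1, (x.1, x.2.2))) => -[x [y z]].
by move=> v x; rewrite !dsum_arrowE.
Qed.

Lemma dsumA M N X : isomorphic (dsum M (dsum N X)) (dsum (dsum M N) X).
Proof.
apply: (isomorphic_fun (g := fun v (x : dsum M (dsum N X) v) =>
  ((x.1, x.2.1), x.2.2) : dsum (dsum M N) X v)) => //.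
- move=> v; exists (fun x => (x.1.1, (x.1.2, x.2))) => [[x [y z]]|[[x y] z]] //.
by move=> v x; rewrite !dsum_arrowE.
Qed.

Lemma zero_rep_dim v (x : @zero_rep K n v) : x = 0.
Proof. by apply/rowP => -[]. Qed.

Lemma dsum0 M : isomorphic (dsum (@zero_rep K n) M) M.
Proof.
apply: (isomorphic_fun (g := fun v (x : dsum (@zero_rep K n) M v) => x.2)) => //.
- move=> v; exists (fun x => (0, x)) => [[x y]|] //=.
  by rewrite [x]zero_rep_dim.
by move=> v x; rewrite !dsum_arrowE.
Qed.

(* The pairs of s are (socle, length). *)
Fixpoint uniserial_sum s : rep K n :=
  if s is x :: s' then dsum (uniserial K x.1 x.2) (uniserial_sum s')
  else @zero_rep K n.

Lemma uniserial_sum_cat s t :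
  isomorphic (uniserial_sum (s ++ t)) (dsum (uniserial_sum s) (uniserial_sum t)).
Proof.
elim: s => [|x s IH] /=; first exact: isomorphic_sym (dsum0 _).
exact: isomorphic_trans (dsum_iso (isomorphic_refl _) IH) (dsumA _ _ _).
Qed.

Lemma uniserial_sum_mid s x t :
  isomorphic (uniserial_sum (s ++ x :: t)) (uniserial_sum (x :: s ++ t)).
Proof.
elim: s => [|y s IH] /=; first exact: isomorphic_refl.
exact: isomorphic_trans (dsum_iso (isomorphic_refl _) IH) (dsumCA _ _ _).
Qed.

Lemma uniserial_sum_perm s t : perm_eq s t ->
  isomorphic (uniserial_sum s) (uniserial_sum t).
Proof.
elim: s t => [|x s IH] t.
  by rewrite perm_sym => /perm_nilP->; apply: isomorphic_refl.
move=> st; have /path.splitPr xt : x \in t by rewrite -(perm_mem st) mem_head.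
case: xt st => t1 t2; rewrite perm_sym perm_catC /= perm_cons perm_catC perm_sym => st.
apply: isomorphic_trans (dsum_iso (isomorphic_refl _) (IH _ st)) _.
exact: isomorphic_sym (uniserial_sum_mid _ _ _).
Qed.

Lemma bigdsum_uniserial m (F : 'I_m -> rep K n) (t : 'I_m -> seq ('I_n.+1 * nat)) :
  (forall j, isomorphic (F j) (uniserial_sum (t j))) ->
  isomorphic (bigdsum F) (uniserial_sum (flatten [seq t j | j <- enum 'I_m])).
Proof.
elim: m F t => [|m IH] F t iF.
  by rewrite enum_ord0; apply: isomorphic_refl.
rewrite enum_ordSl /= -map_comp.
apply: isomorphic_trans _ (isomorphic_sym (uniserial_sum_cat _ _)).
exact: dsum_iso (iF _) (IH _ _ (fun j => iF _)).
Qed.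

Definition parts (p : Pi n) : seq ('I_n.+1 * nat) :=
  flatten [seq [seq (i, l) | l <- val (p i)] | i <- enum 'I_n.+1].

Lemma rep_of_parts (p : Pi n) : isomorphic (rep_of K p) (uniserial_sum (parts p)).
Proof.
apply: bigdsum_uniserial => i.
have -> : [seq (i, l) | l <- val (p i)] =
    flatten [seq [:: (i, nth 0%N (val (p i)) (nat_of_ord k))] | k <- enum 'I_(size (val (p i)))].
  by rewrite flatten_map1 -[in LHS](mkseq_nth 0%N (val (p i))) /mkseq -val_enum_ord -!map_comp.
apply: bigdsum_uniserial => k /=; apply: isomorphic_sym.
apply: (isomorphic_fun (g := fun v (x : dsum _ (@zero_rep K n) v) => x.1)) => //.
- move=> v; exists (fun x => (x, 0)) => [[x y]|] //=.
  by rewrite [y]zero_rep_dim.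
by move=> v x; rewrite !dsum_arrowE.
Qed.

Definition parts_ker_dim s k v : nat :=
  \sum_(x <- s) uniserial_ker_dim x.1 x.2 k v.

Lemma path_ker_dim_uniserial_sum s k v :
  \dim (path_ker (uniserial_sum s) k v) = parts_ker_dim s k v.
Proof.
elim: s => [|x s IH]; last first.
  by rewrite path_ker_dim_dsum path_ker_dim_uniserial IH /parts_ker_dim big_cons.
rewrite /parts_ker_dim big_nil; apply/eqP; rewrite dimv_eq0 -subv0.
by apply/subvP => y _; rewrite [y]zero_rep_dim mem0v.
Qed.

Definition ker_dim (p : Pi n) := parts_ker_dim (parts p).

Lemma path_ker_dim_rep_of (p : Pi n) k v : \dim (path_ker (rep_of K p) k v) = ker_dim p k v.
Proof. by rewrite (path_ker_dim_iso k v (rep_of_parts p)) path_ker_dim_uniserial_sum. Qed.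

Lemma uniserial_sum_nilpotent s : nilpotent_rep (uniserial_sum s).
Proof.
elim: s => [|x s IH] /=; last first.
  by apply/nilpotent_dsum; split=> //; apply: uniserial_nilpotent.
by exists 0%N => v; apply/lfunP => x; rewrite [x]zero_rep_dim !linear0.
Qed.

Lemma rep_of_nilpotent (p : Pi n) : nilpotent_rep (rep_of K p).
Proof. exact: nilpotent_iso (isomorphic_sym (rep_of_parts p)) (uniserial_sum_nilpotent _). Qed.

Lemma nilpotent_uniserial_sum M : nilpotent_rep M ->
  exists2 s, all (fun x => 0 < x.2)%N s & isomorphic M (uniserial_sum s).
Proof.
have [d] := ubnP (\sum_v \dim {:M v}); elim: d M => // d IH M Md nM.
have [[v M0]|M0] := pselect (exists v, {:M v}%VS != 0%VS); last first.
  exists [::] => //; have M0' v (x : M v) : x = 0.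
    apply/eqP; rewrite -memv0; suff <- : {:M v}%VS = 0%VS by apply: memvf.
    by apply/eqP/negPn/negP => Mv; apply: M0; exists v.
  apply: (isomorphic_fun (g := fun v (x : M v) => 0 : @zero_rep K n v)) => [v a x y|v|v x].
  - by rewrite scaler0 addr0.
  - by exists (fun=> 0) => x; rewrite ?[RHS]M0' // [RHS]zero_rep_dim.
  by rewrite linear0.
have [i [l [N [l0 iMN]]]] := split_uniserial nM (ex_intro _ v M0).
have [nU nN] := (nilpotent_dsum _ _).1 (nilpotent_iso iMN nM).
have [|s s0 iNs] := IH N _ nN.
  apply: leq_trans _ (Md : (_ <= d)%N).
  rewrite -(uniserial_dim (K := K) i l) in l0.
  suff -> : (\sum_v \dim {:M v} =
      \sum_v \dim {:uniserial K i l v} + \sum_v \dim {:N v})%N.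
    by rewrite -[X in (X < _)%N]add0n ltn_add2r.
  rewrite -big_split; apply: eq_bigr => w _ /=.
  by rewrite (iso_dim w iMN) !dimvf.
exists ((i, l) :: s); first by rewrite /= l0.
exact: isomorphic_trans iMN (dsum_iso (isomorphic_refl _) iNs).
Qed.

End Classification.

Section Classes.
Context {n : nat}.
Implicit Types (v i u : 'I_n.+1) (s : seq ('I_n.+1 * nat)) (p : Pi n).

Definition partition_of (t : seq nat) : partition_nat :=
  insubd empty_partition (sort geq [seq l <- t | 0 < l]%N).

Lemma partition_ofE t : val (partition_of t) = sort geq [seq l <- t | 0 < l]%N.
Proof.
rewrite insubdK // unfold_in /is_partition sort_sorted; last by move=> a b; apply: leq_total.
by rewrite mem_sort mem_filter.
Qed.

Definition class_of_parts s : Pi n :=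
  [ffun i => partition_of [seq x.2 | x <- s & x.1 == i]].

Lemma count_parts p (a : 'I_n.+1 -> pred nat) :
  count (fun x => a x.1 x.2) (parts p) = (\sum_i count (a i) (val (p i)))%N.
Proof.
rewrite /parts count_flatten sumnE big_map big_map big_enum /=.
by apply: eq_bigr => i _; rewrite count_map; apply: eq_count.
Qed.

Lemma count_parts1 p i (a : pred nat) :
  count (fun x => (x.1 == i) && a x.2) (parts p) = count a (val (p i)).
Proof.
rewrite (count_parts p (fun j l => (j == i) && a l)) (bigD1 i) //= eqxx big1 ?addn0 //.
by move=> j /negPf->; rewrite (eq_count (a2 := pred0)) ?count_pred0.
Qed.

Lemma parts_class_of_parts s : all (fun x => 0 < x.2)%N s ->
  perm_eq (parts (class_of_parts s)) s.
Proof.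
move=> s0; apply/allP => -[i l] _ /=; apply/eqP.
have E x : pred1 (i, l) x = (x.1 == i) && (x.2 == l) by case: x.
rewrite !(eq_count E) (count_parts1 _ i (pred1 l)) ffunE partition_ofE.
rewrite (seq.permP (permEl (perm_sort _ _))) count_filter count_map count_filter.
apply: eq_in_count => x /(allP s0) /= x0; rewrite x0 andbT andbC.
by rewrite eq_sym.
Qed.

Lemma geq_partition_inj (s t : partition_nat) :
  (forall k, count (ltn k) (val s) = count (ltn k) (val t)) -> s = t.
Proof.
case: s t => [s sP] [t tP] /= st; apply/val_inj => /=.
have [/andP[ss s0] /andP[st' t0]] := (sP, tP).
apply: (sorted_eq (leT := geq)) => //.
- by move=> y x z xy yz; apply: leq_trans yz xy.
- by move=> x y; rewrite andbC => /anti_leq.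
apply/allP => l _ /=; apply/eqP.
case: l => [|k]; first by rewrite !(count_memPn _).
have E (r : seq nat) : (count (ltn k) r = count (ltn k.+1) r + count_mem k.+1 r)%N.
  elim: r => //= l r ->; rewrite addnACA; congr addn.
  by rewrite (leq_eqVlt k.+1) eq_sym; case: eqP => [->|]; rewrite ?ltnn ?addn0.
by apply/eqP; rewrite -(eqn_add2l (count (ltn k.+1) s)) -E st E -st.
Qed.

Lemma ker_dimS p k v i : iter k (@ordS n.+1) v = i ->
  ker_dim p k.+1 v = (ker_dim p k v + count (ltn k) (val (p i)))%N.
Proof.
move=> vi; rewrite -(count_parts1 p i) -sum1_count /ker_dim /parts_ker_dim.
rewrite [X in (_ + X)%N]big_mkcond -big_split; apply: eq_bigr => x _ /=.
by rewrite uniserial_ker_dimS vi andbC eq_sym; case: ifP.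
Qed.

Lemma iter_ordS_surj k i : exists v, iter k (@ordS n.+1) v = i.
Proof.
elim: k i => [|k IH] i; first by exists i.
by have [v vi] := IH (ord_pred i); exists v; rewrite iterS vi ord_predK.
Qed.

Lemma ker_dim_inj p p' : ker_dim p =2 ker_dim p' -> p = p'.
Proof.
move=> pp'; apply/ffunP => i; apply: geq_partition_inj => k.
have [v vi] := iter_ordS_surj k i.
by have := pp' k.+1 v; rewrite !(ker_dimS _ vi) pp' => /addnI.
Qed.

Context {K : fieldType}.
Implicit Types (M N : rep K n).

Lemma nilpotent_rep_of M : nilpotent_rep M -> exists p, isomorphic M (rep_of K p).
Proof.
move=> /nilpotent_uniserial_sum[s s0 iM]; exists (class_of_parts s).
apply: isomorphic_trans iM _; apply: isomorphic_sym.
exact: isomorphic_trans (rep_of_parts _) (uniserial_sum_perm (parts_class_of_parts s0)).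
Qed.

Lemma iso_classP M : nilpotent_rep M -> isomorphic M (rep_of K (iso_class M)).
Proof.
move=> /nilpotent_rep_of[p iM].
exact: (@xgetPex _ (Pi0 n) [set q | isomorphic M (rep_of K q)]%classic (ex_intro _ p iM)).
Qed.

Lemma isomorphic_ker_dim M p : nilpotent_rep M ->
  isomorphic M (rep_of K p) <->
  (forall k v, \dim (path_ker M k v) = ker_dim p k v).
Proof.
move=> nM; split=> [iM k v|dM].
  by rewrite (path_ker_dim_iso k v iM) path_ker_dim_rep_of.
have iM := iso_classP nM.
rewrite -(ker_dim_inj (p := iso_class M) (p' := p)) // => k v.
by rewrite -(path_ker_dim_rep_of (K := K)) -(path_ker_dim_iso k v iM).
Qed.

Lemma iso_class_unique M p : isomorphic M (rep_of K p) -> iso_class M = p.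
Proof.
move=> iM; have nM := nilpotent_iso (isomorphic_sym iM) (rep_of_nilpotent p).
apply: ker_dim_inj => k v.
have [dM _] := isomorphic_ker_dim p nM; have [dM' _] := isomorphic_ker_dim (iso_class M) nM.
by rewrite -dM // -dM' //; apply: iso_classP.
Qed.

End Classes.

(** * Greedy subrepresentations *)

Section CorankModulo.
Context {K : fieldType} {V : vectType K}.
Implicit Types (R U W F : {vspace V}).

Definition dim_mod U F : nat := (\dim U - \dim (U :&: F))%N.

Lemma dim_modE U F : (dim_mod U F + \dim (U :&: F))%N = \dim U.
Proof. by rewrite subnK // dimvS // capvSl. Qed.

Lemma dim_mod0 U : dim_mod U 0 = \dim U.
Proof. by rewrite /dim_mod capv0 dimv0 subn0. Qed.

Lemma dim_modS R U F : (R <= U)%VS -> (dim_mod R F <= dim_mod U F)%N.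
Proof.
move=> RU; have := dimvS (addvS RU (subvv F)).
have := dimv_sum_cap R F; have := dimv_sum_cap U F.
by have := dim_modE R F; have := dim_modE U F; lia.
Qed.

Lemma dim_mod_codim U W F : (U <= W)%VS ->
  (dim_mod W F <= dim_mod U F + (\dim W - \dim U))%N.
Proof.
move=> UW; have := dimvS (capvS UW (subvv F)); have := dimvS UW.
by have := dim_modE U F; have := dim_modE W F; lia.
Qed.

Lemma dim_mod_limg (V' : vectType K) (f : 'Hom(V, V')) U (F' : {vspace V'}) :
  (\dim (f @: U) - \dim (f @: U :&: F') = dim_mod U (f @^-1: F'))%N.
Proof.
have fU := limg_ker_dim f U; have := limg_ker_dim f (U :&: (f @^-1: F')).
have -> : (U :&: (f @^-1: F') :&: lker f = U :&: lker f)%VS.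
  rewrite -capvA; congr (_ :&: _)%VS; apply/capv_idPr.
  by rewrite -lpreim0 lpreimS // sub0v.
have -> : (f @: (U :&: (f @^-1: F')) = f @: U :&: F')%VS.
  apply/vspaceP => y; rewrite memv_cap.
  apply/memv_imgP/andP => [[x]|[/memv_imgP[x xU ->] xF]].
    by rewrite memv_cap -memv_preim => /andP[xU xF] ->; rewrite memv_img.
  by exists x; rewrite // memv_cap xU -memv_preim.
by move=> E; have := dim_modE U (f @^-1: F')%VS; lia.
Qed.

Lemma dim_cap_add R U W F : (R <= U)%VS -> (U <= W)%VS ->
  (\dim (U :&: F) + \dim R = \dim (U :&: (W :&: F + R)) + \dim (R :&: F))%N.
Proof.
move=> RU UW.
have -> : (U :&: (W :&: F + R) = U :&: F + R)%VS.
  by rewrite -vspace_modr // capvA (capv_idPl UW).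
have -> : (R :&: F = U :&: F :&: R)%VS by rewrite [RHS]capvC capvA (capv_idPl RU).
by rewrite dimv_sum_cap.
Qed.

(* F k + R is compared with the flag rather than F k itself, since R <= U makes
   the two intersections with U carry the same information. *)
Definition flag_adapted R W (F : nat -> {vspace V}) (X : seq V) :=
  [/\ free X, <<X>>%VS = W, <<take (\dim R) X>>%VS = R &
    forall k, <<take (\dim (W :&: F k + R)%VS) X>>%VS = (W :&: F k + R)%VS].

Lemma flag_adapted_exists R W (F : nat -> {vspace V}) L : (R <= W)%VS ->
  (forall k, (F k <= F k.+1)%VS) -> (W <= F L)%VS -> exists X, flag_adapted R W F X.
Proof.
move=> RW FS WL; pose G k := (if k is k'.+1 then W :&: F k' + R else R)%VS.
have [[|k] _|X [fX sX tX]] := @adapted_basis _ _ G L.+1; first exact: addvSr.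
  by rewrite addvS ?capvS.
have GL : G L.+1 = W by rewrite /G (capv_idPl WL); apply/addv_idPl.
exists X; split=> // [||k]; [by rewrite sX GL|exact: (tX 0%N)|].
have [kL|/ltnW kL] := leqP k L; first exact: (tX k.+1).
have -> : (W :&: F k + R)%VS = G L.+1; last exact: tX.
rewrite GL; have -> : (W :&: F k)%VS = W; last exact/addv_idPl.
apply/capv_idPl; apply: subv_trans WL _.
elim: k kL => [|k IH]; first by rewrite leqn0 => /eqP->.
by rewrite leq_eqVlt ltnS => /orP[/eqP->//|/IH kL]; apply: subv_trans kL _.
Qed.

Lemma flag_member R W (F : nat -> {vspace V}) X m : flag_adapted R W F X ->
  (\dim R <= m)%N -> (m <= \dim W)%N ->
  let U := <<take m X>>%VS in
  [/\ (R <= U)%VS, (U <= W)%VS, \dim U = m &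
   forall k, dim_mod U (F k) = maxn (dim_mod R (F k)) (dim_mod W (F k) - (\dim W - m))].
Proof.
move=> [fX sX tR tG] Rm mW U.
have dX : \dim W = size X by rewrite -sX; apply/eqP.
have RU : (R <= U)%VS by rewrite -tR flag_sub.
have UW : (U <= W)%VS by rewrite -sX -[X in <<X>>%VS]take_size flag_sub // -dX.
have dU : \dim U = m by rewrite dim_flag // -dX.
split=> // k.
have UG : \dim (U :&: (W :&: F k + R))%VS = minn m (\dim (W :&: F k + R)%VS).
  rewrite -{1}(tG k) /U; have [mg|/ltnW gm] := leqP m (\dim (W :&: F k + R)%VS).
    by rewrite (capv_idPl (flag_sub _ mg)) dU.
  by rewrite (capv_idPr (flag_sub _ gm)) tG.
have := dim_cap_add (F k) RU UW; have := dim_cap_add (F k) (subv_trans RU UW) (subvv W).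
have -> : (W :&: (W :&: F k + R) = W :&: F k + R)%VS.
  by apply/capv_idPr; rewrite subv_add capvSl (subv_trans RU).
rewrite UG.
have := dim_modE U (F k); have := dim_modE W (F k); have := dim_modE R (F k).
have := dimvS (capvS UW (subvv (F k))); rewrite dU; lia.
Qed.

Lemma unipotent_flag_step (p : nat) R (F : nat -> {vspace V}) L m :
  p \in [pchar K] -> (forall k, (F k <= F k.+1)%VS) -> F L = fullv ->
  (\dim R <= m)%N -> (m <= \dim {:V})%N ->
  exists (u : 'End(V)) (U0 : {vspace V}) N, [/\
    forall k x, (N <= k)%N -> iter (p ^ k) u x = x,
    forall U, (R <= U)%VS -> [/\ (R <= u @: U)%VS, \dim (u @: U) = \dim U &
      forall k, dim_mod (u @: U) (F k) = dim_mod U (F k)],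
    forall U, \dim U = m -> (u @: U)%VS = U <-> U = U0
  & [/\ (R <= U0)%VS, \dim U0 = m & forall k, dim_mod U0 (F k) =
      maxn (dim_mod R (F k)) (dim_mod fullv (F k) - (\dim {:V} - m))]].
Proof.
move=> pK FS FL Rm mV.
have [|X fX] := flag_adapted_exists (subvf R) FS (L := L); first by rewrite FL.
have [RU _ dU rU] := flag_member fX Rm mV.
have [freeX spanX tR tG] := fX.
have [u [u_flag u_fix u_ord]] := regular_unipotent pK freeX spanX.
have u_inj : injective u.
  have p0 : (0 < p ^ size X)%N by rewrite expn_gt0 (prime_gt0 (pcharf_prime pK)).
  apply: (can_inj (g := iter (p ^ size X).-1 u)) => x.
  by rewrite -iterSr prednK // u_ord.
have dim_u U : \dim (u @: U) = \dim U by rewrite limg_dim_eq // lker_inj.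
have u_take j : (u @: <<take j X>> = <<take j X>>)%VS.
  apply/eqP; rewrite eqEdim dim_u leqnn andbT.
  by apply/subvP => _ /memv_imgP[x xX ->]; apply: u_flag.
exists u, <<take m X>>%VS, (size X); split=> // [U RU'|U dUm].

- have uR : (u @: R)%VS = R by rewrite -tR u_take.
  have RuU : (R <= u @: U)%VS by rewrite -uR limgS.
  split=> // k; have := dim_cap_add (F k) RU' (subvf U).
  have := dim_cap_add (F k) RuU (subvf (u @: U)).
  have -> : (u @: U :&: (fullv :&: F k + R) = u @: (U :&: (fullv :&: F k + R)))%VS.
    rewrite lker0_img_cap; last exact/lker0P.
    by rewrite -[in RHS](tG k) u_take tG.
  rewrite dim_u; have := dim_modE U (F k); have := dim_modE (u @: U) (F k).
  by rewrite dim_u; lia.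
split=> [uU|->]; last exact: u_take.
have [|j jX UE] := u_fix U; first by rewrite uU.
by rewrite UE in dUm *; rewrite (dim_flag freeX jX) in dUm; rewrite dUm.
Qed.

End CorankModulo.

Section Greedy.
Context {K : fieldType} {n : nat}.
Implicit Types (M : rep K n) (d : 'I_n.+1 -> nat).

Definition path_rank M (W : subspaces M) k v := dim_mod (W v) (path_ker M k v).

Lemma path_rank0 M (W : subspaces M) v : path_rank W 0 v = \dim (W v).
Proof. exact: dim_mod0. Qed.

Lemma path_rank_arrow M (W : subspaces M) k v :
  dim_mod (arrow M v @: W v) (path_ker M k (ordS v)) = path_rank W k.+1 v.
Proof. exact: dim_mod_limg. Qed.

Lemma dim_arrow M (W : subspaces M) v : \dim (arrow M v @: W v) = path_rank W 1 v.
Proof. by rewrite -path_rank_arrow [RHS]dim_mod0. Qed.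

Definition semisimple_step M (W U : subspaces M) d :=
  [/\ forall v, (U v <= W v)%VS, forall v, (arrow M v @: W v <= U (ordS v))%VS
    & forall v, (\dim (U v) + d v = \dim (W v))%N].

Lemma semisimple_step_subrep M (W U : subspaces M) d :
  semisimple_step W U d -> is_subrep U.
Proof. by case=> UW WU _ v; apply: subv_trans (limgS _ (UW v)) (WU v). Qed.

Lemma path_rank_step M (W U : subspaces M) d k v : semisimple_step W U d ->
  (maxn (path_rank W k.+1 v) (path_rank W k (ordS v) - d (ordS v)) <=
    path_rank U k (ordS v))%N.
Proof.
move=> [UW WU dU]; rewrite geq_max -path_rank_arrow dim_modS ?WU //=.
have := dim_mod_codim (path_ker M k (ordS v)) (UW (ordS v)).
by have := dU (ordS v); rewrite /path_rank; lia.
Qed.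

Lemma greedy_step M (W : subspaces M) d : nilpotent_rep M -> is_subrep W ->
  (forall v, path_rank W 1 v + d (ordS v) <= \dim (W (ordS v)))%N ->
  exists2 U, semisimple_step W U d & forall k v, path_rank U k (ordS v) =
    maxn (path_rank W k.+1 v) (path_rank W k (ordS v) - d (ordS v)).
Proof.
move=> /nilpotent_path_ker[L kM] sW dW.
have exU v : exists U : {vspace M (ordS v)}, [/\ (arrow M v @: W v <= U)%VS,
    (U <= W (ordS v))%VS, (\dim U + d (ordS v) = \dim (W (ordS v)))%N &
    forall k, dim_mod U (path_ker M k (ordS v)) =
    maxn (path_rank W k.+1 v) (path_rank W k (ordS v) - d (ordS v))].
  have [X fX] := flag_adapted_exists (sW v) (fun k => path_kerS M k (ordS v))
    (eq_ind_r (fun F => W (ordS v) <= F)%VS (subvf _) (kM (ordS v))).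
  have [||RU UW dU rU] := flag_member (m := (\dim (W (ordS v)) - d (ordS v))%N) fX.
  - by rewrite dim_arrow; have := dW v; lia.
  - by lia.
  exists <<take (\dim (W (ordS v)) - d (ordS v)) X>>%VS; split=> // [|k].
    by rewrite dU; have := dW v; lia.
  rewrite rU path_rank_arrow; congr maxn; rewrite /path_rank.
  by have := dW v; lia.
pose U : subspaces M := unshift (fun v => sval (cid (exU v))).
have UP v := svalP (cid (exU v)).
have UE v : U (ordS v) = sval (cid (exU v)) by apply: unshiftE.
exists U; last by move=> k v; rewrite /path_rank UE; have [] := UP v.
split; [apply: ordS_ind => v| move=> v|apply: ordS_ind => v]; rewrite UE;
  by have [] := UP v.
Qed.

Fixpoint semisimple_filtration M (ds : seq ('I_n.+1 -> nat)) (W : subspaces M) : Prop :=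
  if ds is d :: ds' then
    exists2 U, semisimple_step W U d & semisimple_filtration ds' U
  else forall v, W v = 0%VS.

(* Representations with a filtration of given type are closed under
   degeneration: the greedy step has the least path ranks, and these depend
   monotonically on the path ranks of W. *)
Lemma semisimple_filtration_degen M M' ds (W : subspaces M) (W' : subspaces M') :
  nilpotent_rep M' -> is_subrep W' ->
  (forall v, \dim (W v) = \dim (W' v)) ->
  (forall k v, path_rank W' k v <= path_rank W k v)%N ->
  semisimple_filtration ds W -> semisimple_filtration ds W'.
Proof.
move=> nM'; elim: ds W W' => [|d ds IH] W W' sW' dW rW.
  by move=> W0 v; apply/eqP; rewrite -dimv_eq0 -dW W0 dimv0.
case=> U WU fU.
have [_ aU dU] := WU.
have [|U' WU' rU'] := @greedy_step M' W' d nM' sW'.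
  move=> v; rewrite -dW -dU leq_add2r; apply: leq_trans (rW 1%N v) _.
  by rewrite -dim_arrow dimvS.
exists U' => //; apply: (IH U U') => //.
- exact: semisimple_step_subrep WU'.
- by move=> v; have [_ _ dU'] := WU'; have := dU' v; have := dU v; have := dW v; lia.
move=> k; apply: ordS_ind => v; rewrite rU'; apply: leq_trans _ (path_rank_step _ _ WU).
by have := rW k.+1 v; have := rW k (ordS v); lia.
Qed.

End Greedy.

(** * Filtrations with semisimple quotients *)

Section Subquotients.
Context {K : fieldType} {n : nat}.
Implicit Types (M N : rep K n) (v : 'I_n.+1) (d : 'I_n.+1 -> nat).

Lemma subrep_full M : is_subrep (fun v => fullv : {vspace M v}).
Proof. by move=> v; apply: subvf. Qed.

Lemma mem_path_ker_subrep M (U : subspaces M) k v (x : subrep U v) : is_subrep U ->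
  (x \in path_ker (subrep U) k v) = (vsval x \in path_ker M k v).
Proof.
move=> sU; elim: k v x => [|k IH] v x; first by rewrite !memv0.
by rewrite !mem_path_kerS IH subrep_arrowE.
Qed.

Lemma vsval_inj_dim (V : vectType K) (U : {vspace V}) (A : {vspace subvs_of U})
    (B : {vspace V}) :
  (forall x, (x \in A) = (vsval x \in B)) -> \dim A = \dim (U :&: B).
Proof.
move=> AB; rewrite -(limg_dim_eq (f := linfun (vsval : subvs_of U -> V))).
  congr (\dim _); apply/vspaceP => y; rewrite memv_cap.
  apply/memv_imgP/andP => [[x xA ->]|[yU yB]].
    by rewrite linfun_fun_linear // subvsP -AB.
  by exists (vsproj U y); rewrite ?linfun_fun_linear // ?AB vsprojK.
by apply: lker_inj => x y; rewrite !linfun_fun_linear //; apply: subvs_inj.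
Qed.

Lemma dim_subrep M (U : subspaces M) v : \dim {:subrep U v} = \dim (U v).
Proof.
rewrite (vsval_inj_dim (B := fullv)) ?capvf // => x; rewrite !memvf //.
Qed.

Lemma path_ker_dim_subrep M (U : subspaces M) k v : is_subrep U ->
  \dim (path_ker (subrep U) k v) = \dim (U v :&: path_ker M k v).
Proof. by move=> sU; apply: vsval_inj_dim => x; apply: mem_path_ker_subrep. Qed.

Lemma nilpotent_subrep M (U : subspaces M) : is_subrep U -> nilpotent_rep M ->
  nilpotent_rep (subrep U).
Proof.
move=> sU /nilpotent_path_ker[k kM]; apply/nilpotent_path_ker; exists k => v.
by apply/vspaceP => x; rewrite memvf mem_path_ker_subrep // kM memvf.
Qed.

Lemma quot_arrows_zero M (U : subspaces M) : is_subrep U ->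
  arrows_zero (quot U) <-> (forall v, (limg (arrow M v) <= U (ordS v))%VS).
Proof.
move=> sU; split=> [U0 v|MU v x].
  by apply/subvP => _ /memv_imgP[x _ ->]; rewrite -quot_proj_eq0 quot_proj_arrow // U0.
rewrite -[x]quot_proj_surj -quot_proj_arrow //; apply/eqP.
by rewrite quot_proj_eq0 (subvP (MU v)) // memv_img // memvf.
Qed.

Lemma dim_quot M (U : subspaces M) v :
  \dim {:quot U v} = (\dim {:M v} - \dim (U v))%N.
Proof.
rewrite -dimv_compl (vsval_inj_dim (U := (U v)^C%VS) (B := fullv)) ?capvf // => x.
by rewrite !memvf.
Qed.

Lemma quot_isomorphic M (U : subspaces M) N : is_subrep U -> arrows_zero N ->
  isomorphic (quot U) N <->
  (forall v, (limg (arrow M v) <= U (ordS v))%VS) /\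
  (forall v, \dim (U v) + \dim {:N v} = \dim {:M v})%N.
Proof.
move=> sU N0; split=> [iUN|[MU dU]].
  split; first exact/(quot_arrows_zero sU)/(iso_arrows_zero (isomorphic_sym iUN)).
  move=> v; have dUM := dimvS (subvf (U v)).
  by rewrite -(iso_dim v iUN) dim_quot subnKC.
apply: arrows_zero_iso N0 _; first exact/quot_arrows_zero.
by move=> v; rewrite dim_quot -dU addKn.
Qed.

Lemma sub_in_quot_isomorphic M (W U : subspaces M) N : is_subrep W -> is_subrep U ->
  (forall v, (U v <= W v)%VS) -> arrows_zero N ->
  isomorphic (quot (sub_in W U)) N <->
  semisimple_step W U (fun v => \dim {:N v}).
Proof.
move=> sW sU UW N0.
have memUW v (x : subvs_of (W v)) : (x \in sub_in W U v) = (vsval x \in U v).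
  by rewrite -memv_preim linfun_fun_linear.
have dUW v : \dim (sub_in W U v) = \dim (U v).
  by rewrite (vsval_inj_dim (memUW v)); congr (\dim _); apply/capv_idPr.
have sUW : is_subrep (sub_in W U).
  move=> v; apply/subvP => _ /memv_imgP[x xU ->].
  rewrite memUW subrep_arrowE // (subvP (sU v)) // memv_img // -memUW.
  exact: xU.
rewrite quot_isomorphic //; split=> [[aU dU]|[_ aU dU]]; split=> // v.
- apply/subvP => _ /memv_imgP[x xW ->].
  have := subvP (aU v) _ (memv_img (arrow (subrep W) v) (memvf (vsproj (W v) x))).
  by rewrite memUW subrep_arrowE // vsprojK.
- by rewrite -dUW dU dim_subrep.
- apply/subvP => _ /memv_imgP[x _ ->]; rewrite memUW subrep_arrowE //.
  by rewrite (subvP (aU v)) // memv_img // subvsP.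
by rewrite dUW dU dim_subrep.
Qed.

Lemma has_filtrationP (r : nat) (w : 'I_r -> rep K n) M :
  (forall j, arrows_zero (w j)) ->
  has_filtration w M <->
  semisimple_filtration [seq (fun v => \dim {:w j v}) | j <- enum 'I_r]
    (fun v => fullv : {vspace M v}).
Proof.
move=> w0.
have chainP (W : subspaces M) : is_subrep W ->
  semisimple_filtration [seq (fun v => \dim {:w j v}) | j <- enum 'I_r] W <->
  exists c : nat -> subspaces M,
  [/\ forall v, c 0%N v = W v, forall v, c r v = 0%VS,
      forall j, (j <= r)%N -> is_subrep (c j),
      forall j v, (j < r)%N -> (c j.+1 v <= c j v)%VS
    & forall j : 'I_r, isomorphic (quot (sub_in (c j) (c j.+1))) (w j)].
  elim: r w w0 W => [|r IH] w w0 W sW.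
    rewrite enum_ord0; split=> [/= W0|[c [c0 cr _ _ _]] v]; last by rewrite -c0.
    exists (fun=> W); split=> //; by [case|case].
  rewrite enum_ordSl /= -map_comp; split.
    case=> U WU fU; have sU := semisimple_step_subrep WU.
    have /(IH (fun j => w (lift ord0 j)) (fun j => w0 _) U sU)[c [c0 cr cs cd ci]] := fU.
    have c0E : c 0%N = U by apply: functional_extensionality_dep.
    exists (fun j => if j is j'.+1 then c j' else W); split=> //.
    - by case=> // j jr; apply: cs.
    - by case=> [|j] v jr; [rewrite c0; case: WU|apply: cd].
    move=> j; have [j' ->|->] := unliftP ord0 j; first exact: ci.
    apply/sub_in_quot_isomorphic => //; rewrite c0E //.
    by case: WU.
  case=> c [c0 cr cs cd ci].
  have c0E : c 0%N = W by apply: functional_extensionality_dep.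
  exists (c 1%N).
    rewrite -c0E; apply/sub_in_quot_isomorphic; rewrite ?c0E //.
    - exact: cs.
    - by move=> v; rewrite -c0 cd.
    by have := ci ord0; rewrite c0E.
  apply/(IH (fun j => w (lift ord0 j)) (fun j => w0 _)); first exact: cs.
  exists (fun j => c j.+1); split=> // [j jr|j v jr|j]; [exact: cs|exact: cd|].
  exact: (ci (lift ord0 j)).
exact: iff_sym (chainP _ (@subrep_full M)).
Qed.

End Subquotients.

(** * Hall numbers modulo p *)

Section Reduction.
Context {n : nat}.
Implicit Types (v i u : 'I_n.+1) (a b c p : Pi n) (d : 'I_n.+1 -> nat).

Definition class_dim p v : nat :=
  \sum_(x <- parts p) uniserial_ker_dim x.1 x.2 x.2 v.

Definition class_rank p k v : nat := (class_dim p v - ker_dim p k v)%N.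

(* For c, d and b as below, the greedy subrepresentation U of rep_of c with
   semisimple quotient of dimension vector d has class b. *)
Definition reduces c d b : Prop :=
  (forall v, class_dim b v + d v = class_dim c v)%N /\
  forall k v, class_rank b k (ordS v) =
    maxn (class_rank c k.+1 v) (class_rank c k (ordS v) - d (ordS v)).

Lemma class_rank0 p v : class_rank p 0 v = class_dim p v.
Proof.
by rewrite /class_rank /ker_dim /parts_ker_dim big1 ?subn0 // => x _; apply: big_ord0.
Qed.

Lemma uniserial_ker_dim_le i l k v : (uniserial_ker_dim i l k v <= uniserial_ker_dim i l l v)%N.
Proof.
elim: k => [|k IH]; first by rewrite /uniserial_ker_dim big_ord0.
have [kl|lk] := ltnP k l; last by rewrite uniserial_ker_dimS ltnNge lk addn0.
rewrite /uniserial_ker_dim (big_ord_widen l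
  (fun j => (j < l)%N && (iter j (@ordS n.+1) v == i) : nat) kl)
  [leqRHS](bigID (fun j : 'I_l => j < k.+1)%N) /=.
exact: leq_addr.
Qed.

Lemma ker_dim_le p k v : (ker_dim p k v <= class_dim p v)%N.
Proof. by apply: leq_sum => x _; apply: uniserial_ker_dim_le. Qed.

Lemma class_dim0 v : class_dim (Pi0 n) v = 0%N.
Proof.
rewrite /class_dim (_ : parts (Pi0 n) = [::]) ?big_nil // /parts.
by elim: (enum _) => //= i e ->; rewrite ffunE.
Qed.

Section Ranks.
Context {K : fieldType}.
Implicit Types (M N : rep K n).

Lemma dim_uniserial i l v : \dim {:uniserial K i l v} = uniserial_ker_dim i l l v.
Proof.
rewrite -(path_ker_dim_uniserial (K := K)).
rewrite (_ : path_ker (uniserial K i l) l v = fullv) //.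
apply/vspaceP => x; rewrite memvf; apply/mem_path_ker_uniserial => j.
by rewrite leqNgt ltn_ord.
Qed.

Lemma dim_rep_of p v : \dim {:rep_of K p v} = class_dim p v.
Proof.
rewrite (iso_dim v (rep_of_parts p)) /class_dim.
elim: (parts p) => [|[i l] s IH] /=.
  rewrite big_nil; apply/eqP; rewrite dimv_eq0 -subv0; apply/subvP => y _.
  by rewrite (zero_rep_dim (y : (@zero_rep K n) v)) mem0v.
by rewrite big_cons -IH -dim_uniserial !dimvf.
Qed.

Lemma path_rank_rep_of p k v :
  path_rank (fun v => fullv : {vspace rep_of K p v}) k v = class_rank p k v.
Proof. by rewrite /path_rank /dim_mod capfv dim_rep_of path_ker_dim_rep_of. Qed.

Lemma subrep_isomorphic M (U : subspaces M) p : nilpotent_rep M -> is_subrep U ->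
  isomorphic (subrep U) (rep_of K p) <->
  (forall k v, path_rank U k v = class_rank p k v).
Proof.
move=> nM sU; rewrite isomorphic_ker_dim; last exact: nilpotent_subrep.
have le k v : (\dim (U v :&: path_ker M k v) <= \dim (U v))%N by rewrite dimvS ?capvSl.
split=> [iU k v|rU k v]; last first.
  rewrite path_ker_dim_subrep //; have := rU k v; have := rU 0%N v.
  rewrite path_rank0 class_rank0 /path_rank /dim_mod /class_rank.
  by have := le k v; have := ker_dim_le p k v; lia.
have iso : isomorphic (subrep U) (rep_of K p).
  by apply/isomorphic_ker_dim => //; apply: nilpotent_subrep.
rewrite /path_rank /dim_mod -path_ker_dim_subrep // iU.
by rewrite -dim_subrep (iso_dim v iso) dim_rep_of.
Qed.

Definition filtered_by (ds : seq ('I_n.+1 -> nat)) p :=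
  semisimple_filtration ds (fun v => fullv : {vspace rep_of K p v}).

Lemma filtered_by_subspaces ds p M (U : subspaces M) : nilpotent_rep M -> is_subrep U ->
  (forall k v, path_rank U k v = class_rank p k v) ->
  filtered_by ds p <-> semisimple_filtration ds U.
Proof.
move=> nM sU rU; have np := rep_of_nilpotent (K := K) p.
have sp := subrep_full (rep_of K p).
have dU v : \dim (U v) = \dim {:rep_of K p v}.
  by rewrite -path_rank0 rU class_rank0 dim_rep_of.
split; apply: semisimple_filtration_degen => // k v;
  by rewrite rU -(path_rank_rep_of p) leqnn.
Qed.

Lemma filtered_by_cons d ds c :
  filtered_by (d :: ds) c <-> exists2 b, reduces c d b & filtered_by ds b.
Proof.
have nc := rep_of_nilpotent (K := K) c.
have sc := subrep_full (rep_of K c).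
split=> [[U sU fU]|[b [db rb] fb]].
  have [_ aU dU] := sU.
  have [|U' sU' rU'] := greedy_step nc sc (d := d).
    by move=> v; rewrite -dU leq_add2r -dim_arrow dimvS.
  have subU' := semisimple_step_subrep sU'.
  have nU' := nilpotent_subrep subU' nc.
  have [b iU'] := nilpotent_rep_of nU'.
  have rb := (subrep_isomorphic b nc subU').1 iU'.
  exists b; last first.
    apply/(filtered_by_subspaces ds nc subU' rb).
    apply: (semisimple_filtration_degen nc subU' _ _ fU) => [v|k].
      by have [_ _ dU'] := sU'; apply/eqP; rewrite -(eqn_add2r (d v)) dU dU'.
    by apply: ordS_ind => v; rewrite rU'; apply: path_rank_step.
  split=> [v|k v]; last by rewrite -rb rU' !path_rank_rep_of.
  by have [_ _ dU'] := sU'; rewrite -(dim_rep_of c) -dU' -path_rank0 rb class_rank0.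
have [|U sU rU] := greedy_step nc sc (d := d).
  move=> v; rewrite path_rank_rep_of dim_rep_of -db leq_add2r.
  by rewrite -class_rank0 rb leq_maxl.
have rUb k : forall v, path_rank U k v = class_rank b k v.
  by apply: ordS_ind => v; rewrite rU rb !path_rank_rep_of.
by exists U => //; apply/(filtered_by_subspaces ds nc (semisimple_step_subrep sU) rUb).
Qed.

Lemma filtered_by_nil p : filtered_by [::] p <-> p = Pi0 n.
Proof.
split=> [p0|-> v]; last by apply/eqP; rewrite -dimv_eq0 dim_rep_of class_dim0.
have dp v : class_dim p v = 0%N by rewrite -dim_rep_of p0 dimv0.
apply: ker_dim_inj => k v.
by have := ker_dim_le p k v; have := ker_dim_le (Pi0 n) k v; rewrite class_dim0 dp; lia.
Qed.

End Ranks.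

Lemma reduces_inj c d b b' : reduces c d b -> reduces c d b' -> b = b'.
Proof.
move=> [db rb] [db' rb']; apply: ker_dim_inj => k; apply: ordS_ind => v.
have := ker_dim_le b k (ordS v); have := ker_dim_le b' k (ordS v).
have := rb k v; have := rb' k v; have := db (ordS v); have := db' (ordS v).
rewrite /class_rank; lia.
Qed.

Lemma finite_subspaces (K : finFieldType) (X : rep K n) (A : set (subspaces X)) :
  finite_set A.
Proof.
pose g (m : {dffun forall v, 'M[K]_(\dim {:X v})}) : subspaces X :=
  fun v => passmx.vsof (vbasis {:X v}) (m v).
apply: (sub_finite_set (B := range g)); last exact/finite_image/finite_finset.
move=> U _; exists (finfun (fun v => passmx.msof (vbasis {:X v}) (U v))) => //.
apply: functional_extensionality_dep => v; rewrite /g ffunE passmx.msofK //.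
exact: vbasisP.
Qed.

Lemma hall_number_mod (p : nat) a b c d : prime p ->
  (forall (K : fieldType), arrows_zero (rep_of K a)) -> d =1 class_dim a ->
  hall_number (rep_of 'F_p c) (rep_of 'F_p a) (rep_of 'F_p b) =
    `[<reduces c d b>] %[mod p].
Proof.
move=> p_pr a0 da; rewrite /hall_number.
set S := [set U | _]%classic; set X := rep_of 'F_p c.
have finS := finite_subspaces S.
have nX : nilpotent_rep X := rep_of_nilpotent c.
have sX := subrep_full X.
have SE U : S U <-> semisimple_step (fun v => fullv) U d /\
    forall k v, path_rank U k v = class_rank b k v.
  split=> [[sU iU /(quot_isomorphic sU (a0 _))[aU dU]]|[sU rU]].
    split; last exact/subrep_isomorphic.
    by split=> // v; rewrite ?subvf // da -(dim_rep_of (K := 'F_p)) dU.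
  have subU := semisimple_step_subrep sU.
  split=> //; first exact/subrep_isomorphic.
  apply/quot_isomorphic => //; have [_ aU dU] := sU; split=> // v.
  by rewrite -dU da dim_rep_of.
have [feas|nfeas] := pselect (forall v, path_rank (fun v => fullv : {vspace X v}) 1 v
    + d (ordS v) <= \dim {:X (ordS v)})%N; last first.
  have -> : S = set0.
    apply/seteqP; split=> // U /SE[[_ aU dU] _]; apply: nfeas => v.
    by rewrite -dU leq_add2r -dim_arrow dimvS.
  rewrite fset_set0 cardfs0 (_ : `[<_>] = false) //.
  apply/asboolPn => -[db rb]; apply: nfeas => v.
  by rewrite path_rank_rep_of dim_rep_of -db leq_add2r -class_rank0 rb leq_maxl.
have /nilpotent_path_ker[L kL] := nX.
have pF : p \in [pchar 'F_p] by apply: pchar_Fp.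
pose m v := (\dim {:X (ordS v)} - d (ordS v))%N.
have Rm v : (\dim (limg (arrow X v)) <= m v)%N.
  by rewrite (dim_arrow (fun v => fullv)); have := feas v; rewrite /m; lia.
have ex v := unipotent_flag_step pF (fun k => path_kerS X k (ordS v)) (kL (ordS v))
  (Rm v) (leq_subr _ _).
pose u v := sval (cid (ex v)); have ex2 v := svalP (cid (ex v)).
pose V0 v := sval (cid (ex2 v)); have ex3 v := svalP (cid (ex2 v)).
pose N v := sval (cid (ex3 v)).
have uP v : [/\ forall k x, (N v <= k)%N -> iter (p ^ k) (u v) x = x,
    forall U, (limg (arrow X v) <= U)%VS -> [/\ (limg (arrow X v) <= u v @: U)%VS,
      \dim (u v @: U) = \dim U & forall k, dim_mod (u v @: U) (path_ker X k (ordS v)) =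
        dim_mod U (path_ker X k (ordS v))],
    forall U, \dim U = m v -> (u v @: U)%VS = U <-> U = V0 v
  & [/\ (limg (arrow X v) <= V0 v)%VS, \dim (V0 v) = m v & forall k,
      dim_mod (V0 v) (path_ker X k (ordS v)) =
      maxn (dim_mod (limg (arrow X v)) (path_ker X k (ordS v)))
        (dim_mod fullv (path_ker X k (ordS v)) - (\dim {:X (ordS v)} - m v))]].
  exact: (svalP (cid (ex3 v))).
pose U0 : subspaces X := unshift V0.
pose sigma (U : subspaces X) : subspaces X := unshift (fun v => u v @: U (ordS v))%VS.
have stepE U : semisimple_step (fun v => fullv) U d <->
    forall v, (limg (arrow X v) <= U (ordS v))%VS /\ \dim (U (ordS v)) = m v.
  split=> [[_ aU dU] v|mU].
    by split; [apply: aU|have := dU (ordS v); rewrite /m; lia].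
  split=> [v|v|]; [exact: subvf|by have [] := mU v|].
  by apply: ordS_ind => v; have [_ ->] := mU v; have := feas v; rewrite /m; lia.
have sigma_S U : S U -> S (sigma U).
  move=> /SE[/stepE sU rU]; apply/SE; split.
    apply/stepE => v; have [aU dU] := sU v; rewrite /sigma unshiftE.
    by have [_ /(_ _ aU)[? -> _] _ _] := uP v.
  move=> k; apply: ordS_ind => v; rewrite -rU /path_rank /sigma unshiftE.
  by have [aU _] := sU v; have [_ /(_ _ aU)[_ _ ->] _ _] := uP v.
have sigma_order U : S U -> iter (p ^ \max_v N v) sigma U = U.
  move=> /SE[/stepE sU _].
  have aU k v : (limg (arrow X v) <= iter k sigma U (ordS v))%VS.
    elim: k => [|k IH] /=; first by have [] := sU v.
    by rewrite /sigma unshiftE; have [_ /(_ _ IH)[]] := uP v.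
  have dU k v : \dim (iter k sigma U (ordS v)) = \dim (U (ordS v)).
    elim: k => [|k IH] //=; rewrite /sigma unshiftE -IH.
    by have [_ /(_ _ (aU k v))[]] := uP v.
  apply: functional_extensionality_dep; apply: ordS_ind => v.
  apply/eqP; rewrite eq_sym eqEdim dU leqnn andbT.
  apply/subvP => x xU; have [u_ord _ _ _] := uP v.
  rewrite -(u_ord (\max_v N v) x) ?leq_bigmax //.
  by elim: (p ^ _)%N => //= k IH; rewrite /sigma unshiftE memv_img.
have fixE U : S U -> sigma U = U <-> U = U0.
  move=> /SE[/stepE sU _]; split=> [sgU|->].
    apply: functional_extensionality_dep; apply: ordS_ind => v.
    have [_ _ /(_ (U (ordS v))) uU _] := uP v; have [_ dU] := sU v.
    by rewrite /U0 unshiftE; apply/uU => //; rewrite -[in RHS]sgU /sigma unshiftE.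
  apply: functional_extensionality_dep; apply: ordS_ind => v.
  rewrite /sigma /U0 !unshiftE; have [_ _ uU [_ dV _]] := uP v.
  exact/uU.
have S0 : S U0 <-> reduces c d b.
  rewrite SE.
  have step0 : semisimple_step (fun v => fullv) U0 d.
    by apply/stepE => v; rewrite /U0 unshiftE; have [_ _ _ []] := uP v.
  have r0 k v : path_rank U0 k (ordS v) =
      maxn (class_rank c k.+1 v) (class_rank c k (ordS v) - d (ordS v)).
    rewrite -!(path_rank_rep_of (K := 'F_p) c) -path_rank_arrow /path_rank /U0 unshiftE.
    have [_ _ _ [_ _ ->]] := uP v; congr maxn.
    by rewrite /m subKn //; apply: leq_trans (feas v); apply: leq_addl.
  split=> [[_ rU]|[db rb]]; split=> //.
  - move=> v; have [_ _ d0] := step0.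
    by rewrite -(dim_rep_of (K := 'F_p) c) -d0 -path_rank0 rU class_rank0.
  - by move=> k v; rewrite -rU r0.
  by move=> k; apply: ordS_ind => v; rewrite r0 rb.
have memS U : U \in fset_set S <-> S U by rewrite in_fset_set // in_setE.
rewrite (@card_fixed_mod _ p (\max_v N v) (fset_set S) sigma) //; first last.
- by move=> U /memS/sigma_order.
- by move=> U /memS/sigma_S/memS.
congr (_ %% _)%N; have [rcb|nrcb] := asboolP.
  transitivity #|` [fset U0]%fset|; last by rewrite cardfs1.
  congr (#|` _|); apply/fsetP => U; rewrite inE in_fset1.
  apply/andP/eqP => [[/memS SU /eqP/(fixE _ SU)]//|->].
  by have SU0 := S0.2 rcb; split; [apply/memS|apply/eqP/fixE].
apply/eqP; rewrite cardfs_eq0; apply/eqP/fsetP => U; rewrite in_fset0 inE.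
apply/negbTE/negP => /andP[/memS SU /eqP/(fixE _ SU) UE].
by apply: nrcb; apply/S0; rewrite -UE.
Qed.

End Reduction.

(** * Products in the Hall algebra at q = 0 *)

Section Finiteness.
Context {n : nat}.
Implicit Types (p : Pi n).

Lemma sum_class_dim p : (\sum_v class_dim p v = \sum_i sumn (val (p i)))%N.
Proof.
rewrite /class_dim exchange_big /= /parts big_flatten big_map big_enum /=.
apply: eq_bigr => i _; rewrite big_map sumnE; apply: eq_bigr => l _ /=.
rewrite -[RHS](uniserial_dim (K := rat) i l); apply: eq_bigr => v _.
by rewrite -(dim_uniserial (K := rat)).
Qed.

Lemma mem_leq_sumn (s : seq nat) l : l \in s -> (l <= sumn s)%N.
Proof.
elim: s => //= m s IH; rewrite in_cons => /orP[/eqP->|/IH]; first exact: leq_addr.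
by move/leq_trans; apply; apply: leq_addl.
Qed.

Lemma size_leq_sumn (s : seq nat) : (0 \notin s)%N -> (size s <= sumn s)%N.
Proof.
elim: s => //= m s IH; rewrite in_cons negb_or eq_sym -lt0n => /andP[m0 /IH].
by rewrite -add1n; apply: leq_add.
Qed.

Lemma finite_class_dim (D : 'I_n.+1 -> nat) :
  finite_set [set p | class_dim p =1 D]%classic.
Proof.
pose T := (\sum_v D v)%N.
pose g (m : {ffun 'I_n.+1 -> T.-bseq 'I_T.+1}) : Pi n :=
  [ffun i => partition_of [seq val x | x <- m i]].
apply: (sub_finite_set (B := range g)); last exact/finite_image/finite_finset.
move=> p /= pD.
have pT i : (sumn (val (p i)) <= T)%N.
  by rewrite /T -(eq_bigr _ (fun v _ => pD v)) sum_class_dim (bigD1 i) //= leq_addr.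
have sz i : (size [seq inord l : 'I_T.+1 | l <- val (p i)] <= T)%N.
  rewrite size_map; apply: leq_trans (pT i); apply: size_leq_sumn.
  by case: (p i) => s /= /andP[].
exists [ffun i => Bseq (sz i)] => //; apply/ffunP => i; rewrite !ffunE /=.
apply: val_inj; rewrite partition_ofE -map_comp map_id_in => [|l lp]; last first.
  by rewrite /= inordK // ltnS; apply: leq_trans (pT i); apply: mem_leq_sumn.
case: (p i) => s /= /andP[ss s0].
rewrite (all_filterP _) ?sorted_sort //; last first.
  by apply/allP => l ls; rewrite lt0n; apply: contra s0 => /eqP <-.
by move=> y x z xy yz; apply: leq_trans yz xy.
Qed.

End Finiteness.

Section BasisSums.
Context {n : nat}.
Implicit Types (A : set (Pi n)) (a b c : Pi n) (d : 'I_n.+1 -> nat).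

Lemma basis_sum_coeff A c : finite_set A ->
  (\sum_(p \in A) H0_basis p : H0 n)@_c = `[<A c>]%:R.
Proof.
move=> finA; rewrite fsbig_finite //= raddf_sum /=.
have memA p : p \in fset_set A <-> A p by rewrite in_fset_set // in_setE.
have [Ac|nAc] := asboolP.
  rewrite (bigD1_seq c) ?fset_uniq //=; last exact/memA.
  by rewrite mcoeffU eqxx big1 ?addr0 // => p /negPf pc; rewrite mcoeffU pc.
rewrite big_seq big1 // => p /memA Ap; rewrite mcoeffU.
by case: eqP => // pc; case: nAc; rewrite -pc.
Qed.

Variables (f : Pi n -> Pi n -> Pi n -> {poly rat}).
Hypothesis hf : hall_polynomials f.

Lemma hall_poly_at0 a b c d :
  (forall (K : fieldType), arrows_zero (rep_of K a)) -> d =1 class_dim a ->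
  (f a b c).[0] = `[<reduces c d b>]%:R.
Proof.
move=> a0 da.
apply: (horner0_of_mod (h := fun p => hall_number (rep_of 'F_p c) (rep_of 'F_p a) (rep_of 'F_p b))).
move=> p p_pr; split; last exact: hall_number_mod.
by rewrite (hf (isomorphic_refl _) (isomorphic_refl _) (isomorphic_refl _)) card_Fp.
Qed.

Lemma finite_reduces d b : finite_set [set c | reduces c d b]%classic.
Proof.
apply: sub_finite_set (finite_class_dim (fun v => class_dim b v + d v)%N) => c /= [db _] v.
by rewrite db.
Qed.

Lemma basis_mulE a b d :
  (forall (K : fieldType), arrows_zero (rep_of K a)) -> d =1 class_dim a ->
  basis_mul f a b = \sum_(c \in [set c | reduces c d b]%classic) H0_basis c.
Proof.
move=> a0 da; rewrite /basis_mul.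
rewrite -(fsbig_widen [set c | reduces c d b]%classic) //.
  apply: eq_fsbigr => c; rewrite inE /= => rc.
  by rewrite (hall_poly_at0 _ _ a0 da) asboolT // scale1r.
move=> c [_ /= nrc]; rewrite (hall_poly_at0 _ _ a0 da).
by rewrite asboolF // scale0r.
Qed.

Lemma hall_mul_basis_sum a d (B C : set (Pi n)) :
  (forall (K : fieldType), arrows_zero (rep_of K a)) -> d =1 class_dim a ->
  finite_set B -> finite_set C ->
  (forall c, C c <-> exists2 b, reduces c d b & B b) ->
  hall_mul f (H0_basis a) (\sum_(p \in B) H0_basis p) = \sum_(p \in C) H0_basis p.
Proof.
move=> a0 da finB finC CB; set y := \sum_(p \in B) _.
apply/malgP => c; rewrite basis_sum_coeff //.
have yE b : y@_b = `[<B b>]%:R by apply: basis_sum_coeff.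
rewrite /hall_mul msuppU oner_eq0 big_seq_fset1 raddf_sum /=.
have mulE b : (basis_mul f a b)@_c = `[<reduces c d b>]%:R.
  by rewrite (basis_mulE _ a0 da) basis_sum_coeff //; apply: finite_reduces.
under eq_bigr => b _ do rewrite mcoeffZ mcoeffU eqxx mul1r yE mulE.
have [/CB[b rcb Bb]|nC] := asboolP.
  rewrite (bigD1_seq b) ?fset_uniq //=; last by rewrite -mcoeff_neq0 yE asboolT ?oner_eq0.
  rewrite !asboolT // mul1r big1 ?addr0 // => b' /eqP bb'.
  rewrite [X in _ * X](_ : _ = 0) ?mulr0 // asboolF // => rcb'.
  by case: bb'; apply: reduces_inj rcb' rcb.
rewrite big1 // => b _; have [Bb|] := asboolP (B b); last by rewrite mul0r.
by rewrite asboolF ?mulr0 // => rcb; apply: nC; apply/CB; exists b.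
Qed.

End BasisSums.

Section SemisimpleProducts.
Context {K : fieldType} {n : nat}.

Lemma arrows_zero_ker_dim (M : rep K n) p : isomorphic M (rep_of K p) ->
  arrows_zero M <-> (forall v, ker_dim p 1 v = class_dim p v).
Proof.
move=> iM; have dM v : \dim {:M v} = class_dim p v by rewrite (iso_dim v iM) dim_rep_of.
have kM v : \dim (path_ker M 1 v) = ker_dim p 1 v.
  by rewrite (path_ker_dim_iso 1 v iM) path_ker_dim_rep_of.
have mem v x : (x \in path_ker M 1 v) = (arrow M v x == 0) by rewrite mem_path_kerS memv0.
split=> [M0 v|pE v x].
  rewrite -dM -kM; congr (\dim _); apply/vspaceP => x.
  by rewrite mem M0 eqxx memvf.
apply/eqP; rewrite -mem (_ : path_ker M 1 v = fullv) ?memvf //.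
by apply/eqP; rewrite eqEdim subvf kM dM pE leqnn.
Qed.

Lemma filtered_classesE (r : nat) (w : 'I_r -> rep K n) p :
  (forall j, arrows_zero (w j)) ->
  filtered_classes w p <->
  filtered_by (K := K) [seq (fun v => \dim {:w j v}) | j <- enum 'I_r] p.
Proof.
move=> w0; split=> [[M [nM /(has_filtrationP _ w0) fM iM]]|fp].
  have iMp : isomorphic M (rep_of K p) by rewrite -iM; apply: iso_classP.
  apply/(filtered_by_subspaces _ nM (subrep_full M)) => [k v|//].
  rewrite /path_rank /dim_mod capfv (iso_dim v iMp) dim_rep_of.
  by rewrite (path_ker_dim_iso k v iMp) path_ker_dim_rep_of.
exists (rep_of K p); split; first exact: rep_of_nilpotent.
  exact/(has_filtrationP _ w0).
by apply: iso_class_unique; apply: isomorphic_refl.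
Qed.

Lemma filtered_by_dim ds (p : Pi n) : filtered_by (K := K) ds p ->
  forall v, class_dim p v = (\sum_(d <- ds) d v)%N.
Proof.
elim: ds p => [|d ds IH] p.
  by move/filtered_by_nil => -> v; rewrite class_dim0 big_nil.
by case/filtered_by_cons => b [db _] /IH fb v; rewrite big_cons -db fb addnC.
Qed.

Lemma finite_filtered_by ds : finite_set [set p : Pi n | filtered_by (K := K) ds p]%classic.
Proof.
apply: sub_finite_set (finite_class_dim (fun v => \sum_(d <- ds) d v)%N) => p /= fp v.
by rewrite (filtered_by_dim fp).
Qed.

End SemisimpleProducts.
Local Open Scope classical_set_scope.

Theorem theorem3p11 (n : nat) (f : Pi n -> Pi n -> Pi n -> {poly rat})
    (hf : hall_polynomials f)
    (K : fieldType) (r : nat) (w : 'I_r -> rep K n)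
    (w_nil : forall j, nilpotent_rep (w j)) (w_ss : forall j, semisimple_rep (w j)) :
  \big[hall_mul f/H0_basis (Pi0 n)]_(j < r) H0_basis (iso_class (w j)) =
  \sum_(p \in filtered_classes w) H0_basis p.
Proof.
have w0 j : arrows_zero (w j) := semisimple_nilpotent_arrows_zero (w_ss j) (w_nil j).
pose ds r (w : 'I_r -> rep K n) := [seq (fun v => \dim {:w j v}) | j <- enum 'I_r].
have -> : filtered_classes w = [set p | filtered_by (K := K) (ds r w) p].
  by apply/seteqP; split=> p /(filtered_classesE _ w0).
elim: r w w_nil w0 {w_ss} => [|r IH] w w_nil w0.
  rewrite big_ord0 (_ : [set p | _] = [set Pi0 n]) ?fsbig_set1 // /ds enum_ord0.
  by apply/seteqP; split=> p; [move=> /filtered_by_nil|move=> ->; apply/filtered_by_nil].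
rewrite big_ord_recl (IH (fun j => w (lift ord0 j))) //.
have iw := iso_classP (w_nil ord0).
apply: (hall_mul_basis_sum hf (d := fun v => \dim {:w ord0 v})) => //.
- move=> F; apply/(arrows_zero_ker_dim (isomorphic_refl _)).
  exact/(arrows_zero_ker_dim iw).
- by move=> v; rewrite (iso_dim v iw) dim_rep_of.
- exact: finite_filtered_by.
- exact: finite_filtered_by.
by move=> c; rewrite /ds enum_ordSl /= -map_comp; apply: filtered_by_cons.
Qed.
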